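(* The mixing time of the Loyd process on the $n\times n$ torus satisfies $\tau_{\rm mix} = O(n^4\log^2 n)$; that is, there is a universal constant $C>0$ such that $\tau_{\rm mix}\le C\,n^4\log^2 n$ for all $n\ge 2$.
   Context: For $n\ge 2$ let $V_n=\mathbb{Z}_n^2$ be the vertex set of the $n\times n$ torus $G_n$, in which each vertex $v$ is adjacent to $v\pm(1,0)$ and $v\pm(0,1)$. The vertices are occupied by $n^2-1$ distinct tiles and one hole, one particle per vertex. Tiles and hole carry unique labels in $V_n$, the hole having label $(0,0)$, so a configuration is a permutation $\pi$ of $V_n$, with $\pi(v)$ the label of the particle at $v$. If $n$ is even, call a vertex $(y_1,y_2)$ even if $y_1+y_2$ is even and odd otherwise, and let $\Omega$ be the set of configurations $\pi$ such that the parity of the permutation $\pi$ equals the parity of the position of the hole. Loyd process (Loyd chain): at each step, with probability $\frac12$ do nothing; otherwise interchange the hole with one of its four adjacent tiles (one per direction $\pm(1,0),\pm(0,1)$), chosen uniformly at random. The chain is started in $\Omega$ when $n$ is even. Its state space is $\Omega$ if $n$ is even and the set of all permutations of $V_n$ if $n$ is odd; its stationary distribution $\pi$ is uniform on the state space. For a chain on a finite state space $S$ with transition probabilities $p(x,y)$ and stationary distribution $\pi$, set $\|\mu-\nu\|=\frac12\sum_{x\in S}|\mu(x)-\nu(x)|$, $\tau_{\rm mix}(\epsilon)=\min\{t:\|p^t(x,\cdot)-\pi\|\le\epsilon\text{ for all }x\in S\}$ and $\tau_{\rm mix}=\tau_{\rm mix}(e^{-1})$. *)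

(* Defs.v *)
From HB Require Import structures.
From mathcomp Require Import all_boot all_order all_algebra all_fingroup.
From mathcomp Require Import all_classical all_reals all_analysis.
Set Implicit Arguments.
Unset Strict Implicit.
Unset Printing Implicit Defensive.
Import Order.TTheory GRing.Theory Num.Theory.
Local Open Scope ring_scope.

(** * Mixing times of chains on a finite state space *)

Definition tv_dist (R : realType) (S : finType) (mu nu : S -> R) : R :=
  2^-1 * \sum_(x : S) `|mu x - nu x|.

Fixpoint trans_iter (R : realType) (S : finType) (p : S -> S -> R) (t : nat)
    (x y : S) : R :=
  if t is t'.+1 then \sum_(z : S) p x z * trans_iter p t' z y else (x == y)%:R.

Definition mixed_at (R : realType) (S : finType) (p : S -> S -> R)
    (mu : S -> R) (eps : R) (t : nat) : Prop :=
  forall x : S, tv_dist (trans_iter p t x) mu <= eps.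

(* [is_mixing_time p mu eps t] says that the minimum defining the mixing time
   exists and equals [t]; a chain that never mixes has no mixing time. *)
Definition is_mixing_time (R : realType) (S : finType) (p : S -> S -> R)
    (mu : S -> R) (eps : R) (t : nat) : Prop :=
  mixed_at p mu eps t /\ forall s : nat, mixed_at p mu eps s -> (t <= s)%N.

Definition stationary (R : realType) (S : finType) (p : S -> S -> R)
    (mu : S -> R) : Prop :=
  forall y : S, \sum_(x : S) mu x * p x y = mu y.

Definition uniform_dist (R : realType) (S : finType) (_ : S) : R := #|S|%:R^-1.
Arguments uniform_dist : clear implicits.

(** * The Loyd process on the n x n torus *)

(* ['Z_n] is Z/nZ only for [1 < n]; smaller [n] are never used. *)
Notation vertex n := ('Z_n * 'Z_n)%type.

(* [c v] is the label of the particle at [v]; the hole is the particle labelled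
   [0]. *)
Notation config n := {perm vertex n}.

Definition hole (n : nat) (c : config n) : vertex n := (c^-1)%g 0.

(* Computed on the representatives in [0, n); depends only on the vertex itself
   as an element of Z_n^2 when [n] is even, the only case used. *)
Definition vertex_odd (n : nat) (v : vertex n) : bool :=
  odd (v.1 + v.2)%N.

Definition loyd_space (n : nat) : {set config n} :=
  if odd n then [set: config n]
  else [set c : config n | odd_perm c == vertex_odd (hole c)].

Definition loyd_state (n : nat) : finType :=
  {c : config n | c \in loyd_space n}.

(* A list, not a set: for [n = 2] opposite directions coincide in Z_n^2 and each
   of the four directions still has probability 1/4. *)
Definition directions (n : nat) : seq (vertex n) :=
  [:: (1, 0); (-1, 0); (0, 1); (0, -1)].

(* In [perm] the left factor acts first, so positions are swapped, not labels. *)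
Definition move (n : nat) (c : config n) (d : vertex n) : config n :=
  (tperm (hole c) (hole c + d)%R * c)%g.

Definition loyd_trans (R : realType) (n : nat) (x y : loyd_state n) : R :=
  2^-1 * (y == x)%:R +
  2^-1 * (4^-1 * \sum_(d <- directions n) (val y == move (val x) d)%:R).
Arguments loyd_trans : clear implicits.

Lemma hole_move (n : nat) (c : config n) (d : vertex n) :
  hole (move c d) = hole c + d.
Proof. by rewrite /hole /move invMg permM tpermV tpermL. Qed.

Lemma moveK (n : nat) (d : vertex n) (c : config n) :
  move (move c d) (- d) = c.
Proof.
rewrite /(move (move c d) _) hole_move addrK /move mulgA.
by rewrite [X in (X * _ * _)%g]tpermC tperm2 mul1g.
Qed.

Lemma odd_modn (m n : nat) : ~~ odd n -> odd (m %% n) = odd m.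
Proof.
by move=> hn; rewrite [in RHS](divn_eq m n) oddD oddM (negbTE hn) andbF.
Qed.

Lemma vertex_odd_step (n : nat) (v d : vertex n) : (1 < n)%N -> ~~ odd n ->
  d \in directions n -> vertex_odd (v + d) = ~~ vertex_odd v.
Proof.
case: n v d => [|[|n]] // [a b] d _ hn; rewrite !inE => hd.
have E (x y : 'Z_n.+2) : odd (x + y)%R = odd x (+) odd y.
  by rewrite /= odd_modn // oddD.
have N (x : 'Z_n.+2) : odd (- x)%R = odd x.
  by rewrite /= odd_modn // oddB ?(negbTE hn) // ltnW.
have N1 : odd (- 1 : 'Z_n.+2)%R by rewrite N.
have h1 : odd (1 : 'Z_n.+2)%R by [].
have h0 : odd (0 : 'Z_n.+2)%R = false by [].
rewrite /vertex_odd !oddD /= !E.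
by case/or4P: hd => /eqP-> /=; rewrite ?N1 ?h1 ?h0;
  case: (odd a); case: (odd b).
Qed.

Lemma move_loyd_space (n : nat) (c : config n) (d : vertex n) :
  (1 < n)%N -> d \in directions n ->
  (move c d \in loyd_space n) = (c \in loyd_space n).
Proof.
move=> n1 hd; rewrite /loyd_space; case: ifPn => hn; rewrite !inE //.
rewrite hole_move vertex_odd_step // odd_permM odd_tperm.
suff -> : hole c != hole c + d by case: odd_perm; case: vertex_odd.
apply/eqP => /(congr1 (@vertex_odd n)); rewrite vertex_odd_step //.
by case: vertex_odd.
Qed.

Definition loyd_move (n : nat) (x : loyd_state n) (d : vertex n) :
    loyd_state n :=
  insubd x (move (val x) d).

Lemma loyd_trans_sum1 (R : realType) (n : nat) (x : loyd_state n) :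
  (1 < n)%N -> \sum_(y : loyd_state n) loyd_trans R n x y = 1.
Proof.
move=> n1; rewrite big_split /= -!mulr_sumr exchange_big /=.
have S1 (a : loyd_state n) : \sum_(y : loyd_state n) (y == a)%:R = 1 :> R.
  by rewrite (bigD1 a) //= eqxx big1 ?addr0 // => y /negPf->.
rewrite S1 (_ : \sum_(d <- _) _ = 4).
  by rewrite mulr1 mulVf ?pnatr_eq0 // mulr1 [RHS]splitr div1r.
rewrite (_ : 4 = \sum_(d <- directions n) 1).
  apply: eq_big_seq => d hd; apply: etrans (S1 (loyd_move x d)).
  apply: eq_bigr => y _; rewrite -[in RHS](inj_eq val_inj y) /loyd_move.
  by rewrite val_insubd move_loyd_space // (valP x).
by rewrite big_const_seq count_predT /= !addr0 -natr1 -natr1 -natr1 !addrA.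
Qed.

Lemma loyd_trans_sym (R : realType) (n : nat) (x y : loyd_state n) :
  loyd_trans R n x y = loyd_trans R n y x.
Proof.
have M (a b : config n) d : (b == move a d) = (a == move b (- d)).
  apply/eqP/eqP => ->; first by rewrite moveK.
  by rewrite -{2}(opprK d) moveK.
rewrite /loyd_trans eq_sym !big_cons !big_nil !(M (val x)).
have O (a b : 'Z_n) : - (a, b) = (- a, - b) :> vertex n by [].
rewrite !O !oppr0 !opprK !addr0.
by congr (_ + _ * (_ * _)); rewrite addrCA !addrA -!addrA; congr (_ + (_ + _));
  rewrite addrC.
Qed.

Lemma uniform_dist_stationary (R : realType) (n : nat) : (1 < n)%N ->
  stationary (loyd_trans R n) (uniform_dist R (loyd_state n)).
Proof.
move=> n1 y; rewrite /uniform_dist -[RHS]mulr1 -(loyd_trans_sum1 R y n1).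
by rewrite mulr_sumr; apply: eq_bigr => x _; rewrite loyd_trans_sym.
Qed.

(* Main.v *)
Require Import Defs.
From HB Require Import structures.
From mathcomp Require Import all_boot all_order all_algebra all_fingroup.
From mathcomp Require Import all_classical all_reals all_analysis.
From mathcomp Require Import ring lra zify.
Set Implicit Arguments.
Unset Strict Implicit.
Unset Printing Implicit Defensive.
Import Order.TTheory GRing.Theory Num.Theory.
Local Open Scope ring_scope.

(** Following a fixed list of directions is a bijection of the state space.
    Hence, if a map is realised by lists of [O(n)] directions, its Dirichlet
    form is at most [O(n^2)] times that of the Loyd chain. Such lists can move
    the hole by any displacement, and can apply to the tiles at given offsets
    from the hole any transposition composed with a fixed one. Random
    transpositions of [N = n^2] labels satisfy a logarithmic Sobolev inequality
    with constant of order [N ln N], so the chain satisfies one with constant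
    [G = O(n^4 ln n)]. Each step then multiplies the relative entropy by at most
    [1 - 1 / (16 G)]; as it is at most [n^4] at the start, [O(G ln n)] steps
    make it small, and it bounds the total variation distance. *)

(** * Entropy on finite sets *)

(** Entropy replaces the variance because of the size of the state space: a spectral gap argument
    pays the logarithm of the number of states, of order [n^2 ln n], and entropy only the logarithm
    of that. So the two logarithms of the bound differ in origin: one is the price of a logarithmic
    Sobolev inequality on a complete graph, the other that of the initial entropy. The comparison
    needs a list that is the same for every configuration. Positions are therefore measured from the
    hole: in these coordinates a list acts by one permutation, whatever the tiles. Parity is the
    second obstacle: for even [n] a list that returns the hole acts by an even permutation, so a
    lone transposition is out of reach and the fixed one must be carried along. Accordingly the
    entropy is split between the classes given by the hole position and the parity, and the interior
    of each class. *)

Lemma ln_le_sub1 (R : realType) (x : R) : 0 < x -> ln x <= x - 1.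
Proof.
move=> x0; rewrite -[in ln x](subrK 1 x) addrC.
by apply: le_ln1Dx; lra.
Qed.

(** Using [ln r <= r - 1] at the ratio of the square roots, not of the numbers, leaves exactly the
    squared difference of the roots as a gain over the tangent. This gain yields both the entropy
    loss of a step and the total variation bound. *)
Lemma xlnx_ge_tangent (R : realType) (x y : R) : 0 < x -> 0 <= y ->
  y * ln x + (y - x) + (Num.sqrt y - Num.sqrt x) ^+ 2 <= y * ln y.
Proof.
move=> x0; rewrite le_eqVlt => /predU1P[<-|y0].
  by rewrite sqrtr0 !mul0r !sub0r sqrrN (sqr_sqrtr (ltW x0)) ?add0r addNr.
have sq (z : R) : 0 < z -> exists2 a, 0 < a & z = a ^+ 2.
  by move=> z0; exists (Num.sqrt z); rewrite ?sqrtr_gt0 // sqr_sqrtr // ltW.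
have [[a a0 ->] [b b0 ->]] := (sq x x0, sq y y0).
rewrite !sqrtr_sqr !gtr0_norm // !lnXn //.
have := ln_le_sub1 (divr_gt0 a0 b0); rewrite ln_div ?posrE // => h.
have : 2 * b ^+ 2 * (ln a - ln b) <= 2 * b ^+ 2 * (a / b - 1).
  by apply: ler_wpM2l => //; rewrite mulr_ge0 // sqr_ge0.
have -> : 2 * b ^+ 2 * (a / b - 1) = 2 * a * b - 2 * b ^+ 2.
  by field; rewrite gt_eqF.
rewrite !mulr2n; lra.
Qed.

Lemma sum_sqr_sub_ge (R : realType) (T : finType) (S : {set T}) (w : T -> R)
    (x : R) :
  #|S|%:R * (x - (\sum_(s in S) w s) / #|S|%:R) ^+ 2 <=
  \sum_(s in S) (x - w s) ^+ 2.
Proof.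
have [->|S0] := eqVneq #|S| 0%N.
  by rewrite mul0r sumr_ge0 // => s _; rewrite sqr_ge0.
have k0 : (#|S|%:R : R) != 0 by rewrite pnatr_eq0.
set m := (\sum_(s in S) w s) / #|S|%:R.
have -> : \sum_(s in S) (x - w s) ^+ 2 =
    \sum_(s in S) ((x - m) ^+ 2 + (w s - m) ^+ 2) -
    2 * (x - m) * \sum_(s in S) (w s - m).
  by rewrite mulr_sumr -sumrB; apply: eq_bigr => s _; ring.
have -> : \sum_(s in S) (w s - m) = 0.
  by rewrite sumrB sumr_const -[_ *+ #|S|]mulr_natr /m divfK // subrr.
rewrite mulr0 subr0.
rewrite big_split /= sumr_const mulr_natl lerDl.
by rewrite sumr_ge0 // => s _; rewrite sqr_ge0.
Qed.

(** Reverse triangle inequality of the Euclidean norm. The square expanded in [main] gives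
    Cauchy-Schwarz only after multiplication by [p * q], so [p * q = 0] is treated apart. *)
Lemma sqr_sub_sqrt_sum_le (R : realType) (T : finType) (P : pred T)
    (x y : T -> R) :
  (Num.sqrt (\sum_(s | P s) x s ^+ 2) - Num.sqrt (\sum_(s | P s) y s ^+ 2)) ^+ 2
  <= \sum_(s | P s) (x s - y s) ^+ 2.
Proof.
have sq0 (z : T -> R) : 0 <= \sum_(s | P s) z s ^+ 2.
  by apply: sumr_ge0 => s _; rewrite sqr_ge0.
set p := Num.sqrt _; set q := Num.sqrt _.
have p2 : p ^+ 2 = \sum_(s | P s) x s ^+ 2 by rewrite sqr_sqrtr.
have q2 : q ^+ 2 = \sum_(s | P s) y s ^+ 2 by rewrite sqr_sqrtr.
have p0 : 0 <= p by rewrite sqrtr_ge0.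
have q0 : 0 <= q by rewrite sqrtr_ge0.
have -> : \sum_(s | P s) (x s - y s) ^+ 2 =
    p ^+ 2 + q ^+ 2 - 2 * \sum_(s | P s) x s * y s.
  rewrite p2 q2 mulr_sumr -big_split -sumrB /=.
  by apply: eq_bigr => s _; ring.
have main : p * q * \sum_(s | P s) x s * y s <= p * q * (p * q).
  have : 0 <= \sum_(s | P s) (q * x s - p * y s) ^+ 2.
    by apply: sumr_ge0 => s _; rewrite sqr_ge0.
  have -> : \sum_(s | P s) (q * x s - p * y s) ^+ 2 =
     q ^+ 2 * (\sum_(s | P s) x s ^+ 2) + p ^+ 2 * (\sum_(s | P s) y s ^+ 2)
     - 2 * p * q * \sum_(s | P s) x s * y s.
    rewrite !mulr_sumr -big_split -sumrB /=.
    by apply: eq_bigr => s _; ring.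
  rewrite -p2 -q2.
  lra.
have Z (u v : T -> R) : \sum_(s | P s) u s ^+ 2 = 0 ->
    \sum_(s | P s) u s * v s = 0.
  move=> /eqP; rewrite psumr_eq0 => [/allP h|s _]; last exact: sqr_ge0.
  rewrite big1 // => s Ps; have := h s (mem_index_enum s).
  by rewrite Ps /= sqrf_eq0 => /eqP->; rewrite mul0r.
have [pq0|] := ltP 0 (p * q).
  by move: main; rewrite ler_pM2l //; lra.
move=> pq; have {pq} : p * q == 0 by rewrite eq_le pq mulr_ge0.
rewrite mulf_eq0 => /orP[/eqP pz|/eqP qz].
  by move: p2; rewrite pz expr0n /= => /esym /(Z x y) ->; lra.
move: q2; rewrite qz expr0n /= => /esym /(Z y x).
under eq_bigr do rewrite mulrC.
by move=> ->; lra.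
Qed.

(* [#|S|] times the entropy of [u] under the uniform distribution on [S]. *)
Definition ent (R : realType) (T : finType) (S : {set T}) (u : T -> R) : R :=
  \sum_(s in S) u s * ln (u s) -
  (\sum_(s in S) u s) * ln ((\sum_(s in S) u s) / #|S|%:R).

Lemma eq_ent (R : realType) (T : finType) (S : {set T}) (u v : T -> R) :
  {in S, u =1 v} -> ent S u = ent S v.
Proof.
move=> uv; rewrite /ent (eq_bigr v uv); congr (_ - _).
by apply: eq_bigr => s sS; rewrite uv.
Qed.

Lemma ent_le1 (R : realType) (T : finType) (S : {set T}) (u : T -> R) :
  (#|S| <= 1)%N -> ent S u = 0.
Proof.
rewrite leq_eqVlt ltnS leqn0 => /orP[/cards1P[x ->]|].
  by rewrite /ent !big_set1 cards1 divr1 subrr.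
by rewrite cards_eq0 => /eqP ->; rewrite /ent !big_set0 mul0r subrr.
Qed.

(** Variational form of the entropy: the right side is least, and equal to the entropy, when [c] is
    the mean of [u]. A free [c] allows the square of a mean in place of a mean of squares. *)
Lemma ent_le_tangent (R : realType) (T : finType) (S : {set T}) (u : T -> R)
    (c : R) : 0 < c -> (forall s, 0 <= u s) ->
  ent S u <= \sum_(s in S) (u s * ln (u s) - u s * ln c - u s + c).
Proof.
move=> c0 u0; have [/eqP|S0] := eqVneq #|S| 0%N.
  rewrite cards_eq0 => /eqP->; rewrite /ent !big_set0 mul0r subrr.
  by [].
have k0 : 0 < (#|S|%:R : R) by rewrite ltr0n lt0n.
rewrite !(big_split, sumrN) /= -mulr_suml sumr_const -mulr_natl /ent.
set U := \sum_(s in S) u s; set k := #|S|%:R in k0 *.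
have U0 : 0 <= U by apply: sumr_ge0.
have := xlnx_ge_tangent c0 (divr_ge0 U0 (ltW k0)).
set z := (X in _ + X) => h.
have {}h : U / k * ln c + (U / k - c) <= U / k * ln (U / k).
  by apply: le_trans h; rewrite lerDl sqr_ge0.
have := ler_wpM2l (ltW k0) h.
have -> : k * (U / k * ln (U / k)) = U * ln (U / k).
  by field; rewrite gt_eqF.
have -> : k * (U / k * ln c + (U / k - c)) = U * ln c + U - k * c.
  by field; rewrite gt_eqF.
lra.
Qed.

Lemma sqr_ln_sqr_le (R : realType) (k m w : R) : 1 <= k -> 0 < m -> 0 <= w ->
  w <= k * m ->
  w ^+ 2 * ln (w ^+ 2) - w ^+ 2 * ln (m ^+ 2) - w ^+ 2 + m ^+ 2 <=
  (5 + 8 * ln k) * (w - m) ^+ 2.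
Proof.
move=> k1 m0; have lnk : 0 <= ln k by rewrite ln_ge0.
rewrite le_eqVlt => /predU1P[<- _|w0 wk].
  rewrite expr0n /= !mul0r !subr0 add0r sub0r sqrrN.
  rewrite -{1}[m ^+ 2]mul1r ler_wpM2r ?sqr_ge0 //; lra.
rewrite !lnXn // -![ln _ *+ 2]mulr_natr.
have -> : w ^+ 2 * (ln w * 2%:R) - w ^+ 2 * (ln m * 2%:R) =
  2 * w ^+ 2 * ln (w / m) by rewrite ln_div //; ring.
(* Up to [2 * m] the linear bound on the logarithm costs the factor [2 * (w / m) + 1 <= 5]. Beyond
   it [w <= 2 * (w - m)] and the logarithm is at most [ln k], whence [8 * ln k]. *)
have [w2|w2] := leP w (2 * m).
  have : 2 * w ^+ 2 * ln (w / m) <= 2 * w ^+ 2 * (w / m - 1).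
    by apply: ler_wpM2l; [nra|apply: ln_le_sub1; rewrite divr_gt0].
  have : 2 * w ^+ 2 * (w / m - 1) - w ^+ 2 + m ^+ 2 =
     (w - m) ^+ 2 * (2 * (w / m) + 1) by field; rewrite gt_eqF.
  have z2 : w / m <= 2 by rewrite ler_pdivrMr.
  have := sqr_ge0 (w - m); move: (w / m) z2 => z z2 s0.
  have : (w - m) ^+ 2 * (2 * z + 1) <= (w - m) ^+ 2 * 5.
    by apply: ler_wpM2l => //; lra.
  nra.
have : ln (w / m) <= ln k.
  by rewrite ler_ln ?posrE ?divr_gt0 ?ler_pdivrMr // (lt_le_trans _ k1).
have h : w ^+ 2 <= 4 * (w - m) ^+ 2 by nra.
move=> hl; have : w ^+ 2 * ln (w / m) <= w ^+ 2 * ln k.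
  by rewrite ler_wpM2l // sqr_ge0.
have : w ^+ 2 * ln k <= 4 * (w - m) ^+ 2 * ln k by rewrite ler_wpM2r.
have := sqr_ge0 (w - m).
nra.
Qed.

(** Logarithmic Sobolev inequality of the complete graph on [S]. The pointwise bound applies around
    the mean [m] because a nonnegative term is at most the whole sum, [#|S|%:R * m]. *)
Lemma ent_sqr_le (R : realType) (T : finType) (S : {set T}) (w : T -> R) :
  (forall s, 0 <= w s) ->
  ent S (fun s => w s ^+ 2) <=
  (5 + 8 * ln #|S|%:R) / #|S|%:R *
    \sum_(a in S) \sum_(b in S) (w a - w b) ^+ 2.
Proof.
move=> w0; have [S0|S0] := posnP #|S|.
  by rewrite ent_le1 ?S0 // invr0 mulr0 mul0r.
have k1 : 1 <= (#|S|%:R : R) by rewrite ler1n.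
have k0 : 0 < (#|S|%:R : R) by rewrite ltr0n.
have lnk : 0 <= ln (#|S|%:R : R) by rewrite ln_ge0.
have B0 : 0 <= (5 + 8 * ln #|S|%:R : R) by lra.
set m := (\sum_(s in S) w s) / #|S|%:R.
have : 0 <= m by rewrite divr_ge0 ?sumr_ge0.
have wle s : s \in S -> w s <= #|S|%:R * m.
  move=> sS; rewrite /m mulrC divfK ?gt_eqF //.
  by rewrite (bigD1 s) //= lerDl sumr_ge0.
rewrite le_eqVlt => /predU1P[mz|m0].
  have wz s : s \in S -> w s = 0.
    move=> sS; apply/eqP; rewrite eq_le w0 andbT.
    by apply: le_trans (wle s sS) _; rewrite -mz mulr0.
  rewrite (@eq_ent _ _ _ _ (fun=> 0)) => [|s sS]; last by rewrite wz // expr0n.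
  rewrite /ent big1 => [|s _]; last by rewrite mul0r.
  rewrite big1 // mul0r subrr mulr_ge0 ?divr_ge0 ?(ltW k0) //.
  by rewrite sumr_ge0 // => a _; rewrite sumr_ge0 // => b _; rewrite sqr_ge0.
apply: (@le_trans _ _ (\sum_(s in S) (5 + 8 * ln #|S|%:R) * (w s - m) ^+ 2)).
  apply: le_trans (ent_le_tangent S (exprn_gt0 2 m0) _) _ => [s|].
    exact: sqr_ge0.
  by apply: ler_sum => s sS; apply: sqr_ln_sqr_le => //; exact: wle.
rewrite -mulr_sumr -mulrA ler_wpM2l // ler_pdivlMl // mulr_sumr.
by apply: ler_sum => a aS; exact: sum_sqr_sub_ge.
Qed.

(** * Decomposition of entropy over the fibres of a map *)

Lemma ent_chain (R : realType) (T K : finType) (S : {set T}) (K0 : {set K})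
    (p : T -> K) (m : nat) (u : T -> R) :
  (0 < m)%N -> {in S, forall s, p s \in K0} ->
  {in K0, forall a, #|[set s in S | p s == a]| = m} ->
  ent S u = \sum_(a in K0) ent [set s in S | p s == a] u +
    m%:R * ent K0 (fun a => (\sum_(s in S | p s == a) u s) / m%:R).
Proof.
move=> m0 pK cm; have m0' : (m%:R : R) != 0 by rewrite pnatr_eq0 -lt0n.
have part (w : T -> R) :
    \sum_(s in S) w s = \sum_(a in K0) \sum_(s in S | p s == a) w s.
  by rewrite (partition_big p (mem K0)).
have cS : #|S| = (#|K0| * m)%N.
  rewrite -sum1_card (partition_big p (mem K0)) //= -sum_nat_const.
  apply: eq_bigr => a aK; rewrite -(cm a aK) -sum1_card.
  by apply: eq_bigl => s; rewrite inE.
have E a (w : T -> R) : \sum_(s in [set s in S | p s == a]) w s =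
    \sum_(s in S | p s == a) w s by apply: eq_bigl => s; rewrite inE.
rewrite {3}/ent /= -mulr_suml -part.
rewrite [X in X + _](eq_bigr (fun a => \sum_(s in S | p s == a) u s * ln (u s) -
  (\sum_(s in S | p s == a) u s) * ln ((\sum_(s in S | p s == a) u s) / m%:R)));
  last by move=> a aK; rewrite /ent !E cm.
rewrite sumrB -part mulrBr mulr_sumr.
rewrite [X in _ + (X - _)](eq_bigr (fun a => (\sum_(s in S | p s == a) u s) *
  ln ((\sum_(s in S | p s == a) u s) / m%:R))); last first.
  by move=> a aK; rewrite mulrA; congr (_ * _); rewrite mulrC divfK.
rewrite addrA subrK /ent cS; congr (_ - _).
rewrite mulrA [X in _ = X * _]mulrC divfK //; congr (_ * ln _).
by rewrite mulnC natrM invfM mulrA.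
Qed.

(** The complete-graph inequality is applied to [G], the root mean square of [f] on each fibre.
    Since [phi a b] carries one fibre onto another of equal size, the reverse triangle inequality
    bounds [G a - G b] by the differences of [f] along [phi a b]. *)
Lemma ent_blocks (R : realType) (T K : finType) (S : {set T}) (K0 : {set K})
    (p : T -> K) (m : nat) (phi : K -> K -> T -> T) (f : T -> R) :
  (0 < m)%N -> {in S, forall s, p s \in K0} ->
  {in K0, forall a, #|[set s in S | p s == a]| = m} ->
  {in K0 &, forall a b, injective (phi a b)} ->
  {in K0 &, forall a b s, s \in S -> p s = a ->
    phi a b s \in S /\ p (phi a b s) = b} ->
  ent S (fun s => f s ^+ 2) <=
  \sum_(a in K0) ent [set s in S | p s == a] (fun s => f s ^+ 2) +
  (5 + 8 * ln #|K0|%:R) / #|K0|%:R *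
  \sum_(a in K0) \sum_(b in K0) \sum_(s in S | p s == a)
    (f s - f (phi a b s)) ^+ 2.
Proof.
move=> m0 pK cm phi_inj phiS; have m0' : 0 < (m%:R : R) by rewrite ltr0n.
rewrite (ent_chain _ m0 pK cm) lerD2l.
pose G a := Num.sqrt ((\sum_(s in S | p s == a) f s ^+ 2) / m%:R).
have sq0 a : 0 <= \sum_(s in S | p s == a) f s ^+ 2.
  by apply: sumr_ge0 => s _; rewrite sqr_ge0.
rewrite (@eq_ent _ _ K0 _ (fun a => G a ^+ 2)) => [|a _]; last first.
  by rewrite sqr_sqrtr // divr_ge0 // ltW.
have G0 a : 0 <= G a by rewrite sqrtr_ge0.
apply: le_trans (ler_wpM2l (ltW m0') (ent_sqr_le K0 G0)) _.
rewrite mulrCA; case: (posnP #|K0|) => [->|K00].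
  by rewrite invr0 mulr0 !mul0r.
apply: ler_wpM2l.
  apply: divr_ge0 => //; apply: addr_ge0 => //; apply: mulr_ge0 => //.
  by apply: ln_ge0; rewrite ler1n.
rewrite mulr_sumr; apply: ler_sum => a aK.
rewrite mulr_sumr; apply: ler_sum => b bK.
have -> : G b = Num.sqrt
    ((\sum_(s in S | p s == a) f (phi a b s) ^+ 2) / m%:R).
  congr (Num.sqrt (_ / _)).
  have E : phi a b @: [set s in S | p s == a] = [set s in S | p s == b].
    apply/eqP; rewrite eqEcard card_imset ?cm //; last exact: phi_inj.
    rewrite leqnn andbT; apply/fintype.subsetP => _ /imsetP[s sS ->].
    move: sS; rewrite !inE => /andP[sS /eqP ps].
    by have [-> ->] := phiS a b aK bK s sS ps; rewrite eqxx.
  rewrite (eq_bigl (mem [set s in S | p s == b])) => [|s]; last by rewrite !inE.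
  rewrite -E big_imset /=; last by move=> s t _ _ /(phi_inj a b aK bK).
  by apply: eq_bigl => s; rewrite inE.
have sq1 : 0 <= \sum_(s in S | p s == a) f (phi a b s) ^+ 2.
  by apply: sumr_ge0 => s _; rewrite sqr_ge0.
rewrite /G (sqrtrM _ (sq0 a)) (sqrtrM _ sq1) -mulrBl exprMn.
rewrite (@sqr_sqrtr _ m%:R^-1) ?invr_ge0 ?ler0n // mulrC divfK ?gt_eqF //.
exact: sqr_sub_sqrt_sum_le.
Qed.

(** The hypothesis says, through sums, that [phi] covers [S'] exactly [r] times. It serves with
    [r = 1] for injections and with [r = 2] to fold odd permutations onto even ones. *)
Lemma ent_cover (R : realType) (T T' : finType) (S : {set T}) (S' : {set T'})
    (phi : T -> T') (r : nat) (u : T' -> R) :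
  (0 < r)%N ->
  (forall w : T' -> R,
     \sum_(s in S) w (phi s) = r%:R * \sum_(s in S') w s) ->
  ent S (u \o phi) = r%:R * ent S' u.
Proof.
move=> r0 phiE; have r0' : (r%:R : R) != 0 by rewrite pnatr_eq0 -lt0n.
have cS : (#|S|%:R : R) = r%:R * #|S'|%:R.
  by rewrite -[#|S|]sum1_card -[#|S'|]sum1_card !natr_sum (phiE (fun=> 1)).
rewrite /ent (phiE (fun s => u s * ln (u s))) (phiE u) cS mulrBr mulrA.
by congr (_ - _ * ln _); rewrite -mulf_div divff // mul1r.
Qed.

Lemma ent_imset (R : realType) (T T' : finType) (S : {set T})
    (phi : T -> T') (u : T' -> R) : injective phi ->
  ent (phi @: S) u = ent S (u \o phi).
Proof.
move=> phi_inj; rewrite (@ent_cover _ _ _ _ (phi @: S) _ 1) ?mul1r // => w.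
by rewrite mul1r big_imset //= => s t _ _ /phi_inj.
Qed.

(** * Random transpositions *)

Lemma perm_on_fiber (T : finType) (A : {set T}) (i a : T) :
  i \in A -> a \in A ->
  [set s in [set s | perm_on A s] | s i == a] =
  mulg^~ (tperm i a) @: [set s | perm_on (A :\ i) s].
Proof.
move=> iA aA; have tA : perm_on A (tperm i a).
  apply/fintype.subsetP => x; rewrite !inE.
  by case: tpermP => [->|->|]; rewrite ?eqxx.
apply/setP => s; rewrite !inE; apply/andP/imsetP => [[sA /eqP si]|[g]].
  exists (s * tperm i a)%g; last by rewrite -mulgA tperm2 mulg1.
  rewrite inE; apply/fintype.subsetP => x; rewrite !inE => hx.
  apply/andP; split.
    by apply: contraNneq hx => ->; rewrite permM si tpermR.
  by apply: contraNT hx => xA; rewrite (out_perm (perm_onM sA tA)).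
rewrite inE => gA ->; split.
  apply: perm_onM => //; apply: fintype.subset_trans gA _.
  exact: subsetDl.
by rewrite permM (out_perm gA) ?tpermL // !inE eqxx.
Qed.

(* A logarithmic Sobolev inequality for random transpositions, by conditioning
   on the image of a point [i] of [A] and averaging over [i]. *)
Lemma ent_perm_on (R : realType) (T : finType) (A : {set T}) (L : R)
    (f : {perm T} -> R) : ln #|A|%:R <= L -> 0 <= L ->
  ent [set s | perm_on A s] (fun s => f s ^+ 2) <=
  (5 + 8 * L) / #|A|%:R *
  \sum_(i in A) \sum_(j in A) \sum_(s | perm_on A s)
    (f s - f (tperm i j * s)%g) ^+ 2.
Proof.
have [k] := ubnP #|A|; elim: k A f => // k IH A f Ak lnA L0.
have B0 : 0 <= 5 + 8 * L by lra.
pose D i j := \sum_(s | perm_on A s) (f s - f (tperm i j * s)%g) ^+ 2.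
have D0 i j : 0 <= D i j by apply: sumr_ge0 => s _; exact: sqr_ge0.
have [A1|A1] := leqP #|A| 1.
  rewrite ent_le1; last first.
    by rewrite cardsE card_perm; case: #|A| A1 => [|[]].
  apply: mulr_ge0; first by rewrite divr_ge0.
  by apply: sumr_ge0 => i _; apply: sumr_ge0 => j _; exact: D0.
have kA : 1 < (#|A|%:R : R) by rewrite ltr1n.
(* The blocks are the fibres of the image of [i]. The first term gathers the induction hypothesis on
   [A :\ i] over all fibres; the second comes from passing between fibres by [s * tperm a b]. *)
have step i : i \in A -> ent [set s | perm_on A s] (fun s => f s ^+ 2) <=
    (5 + 8 * L) / (#|A|%:R - 1) *
      (\sum_(j in A :\ i) \sum_(l in A :\ i) D j l) +
    (5 + 8 * L) / #|A|%:R * \sum_(j in A) D i j.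
  move=> iA; have cAi : #|A :\ i| = #|A|.-1 by rewrite (cardsD1 i A) iA.
  have inA a : a \in A -> #|[set s in [set s | perm_on A s] | s i == a]| =
      (#|A|.-1)`!.
    move=> aA; rewrite perm_on_fiber // card_imset; last exact: mulIg.
    by rewrite cardsE card_perm cAi.
  have tA a b : a \in A -> b \in A -> perm_on A (tperm a b).
    move=> aA bA; apply/fintype.subsetP => x; rewrite !inE.
    by case: tpermP => [->|->|]; rewrite ?eqxx.
  have := @ent_blocks R _ T [set s | perm_on A s] A (fun s => s i)
    (#|A|.-1)`! (fun a b s => (s * tperm a b)%g) f.
  move=> /(_ (fact_gt0 _)) /(_ _ inA) h.
  apply: le_trans (h _ _ _) _ => {h}.
  - by move=> s; rewrite inE => sA; rewrite perm_closed.
  - by move=> a b _ _; exact: mulIg.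
  - move=> a b aA bA s; rewrite !inE => sA <-.
    rewrite permM tpermL; split=> //; apply: perm_onM => //.
    by apply: tA => //; rewrite perm_closed.
  apply: lerD.
    have -> : \sum_(j in A :\ i) \sum_(l in A :\ i) D j l =
      \sum_(a in A) \sum_(j in A :\ i) \sum_(l in A :\ i)
        \sum_(s | perm_on (A :\ i) s)
        (f (s * tperm i a)%g - f (tperm j l * s * tperm i a)%g) ^+ 2.
      rewrite [RHS]exchange_big /=; apply: eq_bigr => j jA.
      rewrite [RHS]exchange_big /=; apply: eq_bigr => l lA.
      rewrite /D (partition_big (fun s : {perm T} => s i) (mem A)) /=;
        last by move=> s sA; rewrite perm_closed.
      apply: eq_bigr => a aA.
      rewrite (eq_bigl (mem [set s in [set s | perm_on A s] | s i == a]));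
        last by move=> s; rewrite !inE.
      rewrite perm_on_fiber // big_imset /=; last by move=> s t _ _ /mulIg.
      rewrite (eq_bigl (perm_on (A :\ i))) => [|s]; last by rewrite inE.
      by apply: eq_bigr => s _; rewrite mulgA.
    rewrite mulr_sumr; apply: ler_sum => a aA.
    rewrite perm_on_fiber // ent_imset; last exact: mulIg.
    have -> : #|A|%:R - 1 = #|A :\ i|%:R :> R.
      by rewrite cAi -subn1 natrB // ltnW.
    apply: (IH _ (fun s => f (s * tperm i a)%g)) => //.
      by rewrite cAi -ltnS prednK // ltnW.
    apply: le_trans lnA;
    rewrite ler_ln ?posrE ?ltr0n ?cAi ?ler_nat ?leq_pred //.
      by rewrite -subn1 subn_gt0.
    exact: ltnW.
  rewrite -2!mulrA; apply: ler_pM.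
  - by rewrite addr_ge0 // mulr_ge0 // ln_ge0 // ltW.
  - rewrite mulr_ge0 ?invr_ge0 //; apply: sumr_ge0 => a _.
    by apply: sumr_ge0 => b _; apply: sumr_ge0 => s _; exact: sqr_ge0.
  - lra.
  apply: ler_wpM2l; first by rewrite invr_ge0.
  under eq_bigr do rewrite exchange_big /=.
  rewrite /D [leRHS]exchange_big /=.
  rewrite [leRHS](partition_big (fun s : {perm T} => s i) (mem A)) /=;
    last by move=> s sA; rewrite perm_closed.
  apply: ler_sum => a aA.
  rewrite [leLHS](eq_bigl (fun s => perm_on A s && (s i == a))) => [|s];
    last by rewrite inE.
  apply: ler_sum => s /andP[sA /eqP <-].
  (* With [b = s j], the right factor [tperm (s i) (s j)] becomes the left factor [tperm i j], so
     the sum over target fibres is a sum over [j]. *)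
  rewrite (reindex_inj (@perm_inj _ s)) /=.
  rewrite (eq_bigl (mem A)) => [|j]; last by rewrite /= perm_closed.
  apply: ler_sum => j _.
  by rewrite -(tpermJ i j s) /conjg mulgA mulgV mul1g.
have k0 : 0 < (#|A|%:R : R) by rewrite ltr0n ltnW.
rewrite -(ler_pM2l k0).
have -> : #|A|%:R * ent [set s | perm_on A s] (fun s => f s ^+ 2) =
    \sum_(i in A) ent [set s | perm_on A s] (fun s => f s ^+ 2).
  by rewrite sumr_const mulr_natl.
apply: (@le_trans _ _ (\sum_(i in A) ((5 + 8 * L) / (#|A|%:R - 1) *
      (\sum_(j in A :\ i) \sum_(l in A :\ i) D j l) +
    (5 + 8 * L) / #|A|%:R * \sum_(j in A) D i j))); first exact: ler_sum.
rewrite big_split /= -!mulr_sumr.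
set DD := \sum_(i in A) \sum_(j in A) D i j.
have DD0 : 0 <= DD by apply: sumr_ge0 => i _; apply: sumr_ge0.
(* A pair [j != l] is kept by the [#|A| - 2] choices of [i] outside it; the diagonal terms
   vanish. *)
have DDle : \sum_(i in A) \sum_(j in A :\ i) \sum_(l in A :\ i) D j l <=
    (#|A|%:R - 2) * DD.
  rewrite (exchange_big_dep (mem A)) /=; last first.
    by move=> i j iA; rewrite !inE => /andP[].
  rewrite mulr_sumr; apply: ler_sum => j jA.
  rewrite (exchange_big_dep (mem A)) /=; last first.
    by move=> i l _; rewrite !inE => /andP[].
  rewrite mulr_sumr; apply: ler_sum => l lA.
  have [->|jl] := eqVneq j l.
    have -> : D l l = 0.
      by rewrite /D big1 // => s _; rewrite tperm1 mul1g subrr expr0n.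
    by rewrite big1 // mulr0.
  rewrite sumr_const -[D j l *+ _]mulr_natl ler_wpM2r //.
  have cA : #|A| = (#|A :\ j :\ l|.+2)%N.
    by rewrite (cardsD1 j) jA (cardsD1 l (A :\ j)) !inE lA eq_sym jl.
  rewrite [in leRHS]cA -[_.+2]addn2 natrD addrK ler_nat.
  apply: subset_leq_card; apply/fintype.subsetP => i.
  rewrite unfold_in /= !inE => /andP[/andP[iA /andP[ji _]] /andP[li _]].
  by rewrite eq_sym li eq_sym ji.
apply: (@le_trans _ _ ((5 + 8 * L) / (#|A|%:R - 1) * ((#|A|%:R - 2) * DD) +
   (5 + 8 * L) / #|A|%:R * DD)).
  by rewrite lerD2r; apply: ler_wpM2l => //; rewrite divr_ge0 // subr_ge0 ltW.
move: (#|A|%:R : R) kA k0 => x x1 x0.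
have xV : x^-1 <= (x - 1)^-1 by rewrite lef_pV2 ?posrE ?subr_gt0 //; lra.
have -> : x * ((5 + 8 * L) / x * DD) = (5 + 8 * L) * DD.
  by field; rewrite gt_eqF.
(* The averaged factor is [(x - 2) / (x - 1) + 1 / x <= 1], so the induction closes with an
   unchanged constant. *)
have -> : (5 + 8 * L) / (x - 1) * ((x - 2) * DD) + (5 + 8 * L) / x * DD =
    (5 + 8 * L) * DD * (1 - (x - 1)^-1 + x^-1).
  by field; rewrite !gt_eqF // subr_gt0.
rewrite -[leRHS]mulr1; apply: ler_wpM2l; first exact: mulr_ge0.
by lra.
Qed.

(** * Lists of moves and the tiles around the hole *)

Definition moves (n : nat) (c : config n) (w : seq (vertex n)) : config n :=
  foldl (@move n) c w.

Definition shift_perm (n : nat) (d : vertex n) : {perm vertex n} :=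
  perm (@addIr _ d).

(* Relative to the hole, the move [d] takes the tile at [d] to [- d] and any
   other tile from [x] to [x - d]. *)
Definition frame_step (n : nat) (d : vertex n) : {perm vertex n} :=
  (tperm (0%R : vertex n) d * shift_perm (- d)%R)%g.

Definition frame_perm (n : nat) (w : seq (vertex n)) : {perm vertex n} :=
  (\prod_(d <- w) frame_step d)%g.

Definition rev_word (n : nat) (w : seq (vertex n)) : seq (vertex n) :=
  rev [seq - d | d <- w].

Definition word_in (n : nat) (w : seq (vertex n)) : bool :=
  all (mem (directions n)) w.

Lemma shift_permD (n : nat) (a b : vertex n) :
  (shift_perm a * shift_perm b)%g = shift_perm (a + b).
Proof. by apply/permP => x; rewrite permM !permE addrA. Qed.

Lemma shift_perm0 (n : nat) : shift_perm (0 : vertex n) = 1%g.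
Proof. by apply/permP => x; rewrite permE perm1 addr0. Qed.

Lemma shift_permN (n : nat) (a : vertex n) :
  shift_perm (- a) = (shift_perm a)^-1%g.
Proof.
by apply/eqP; rewrite eq_mulgV1 invgK shift_permD addNr shift_perm0.
Qed.

Lemma tperm_shift (n : nat) (x y d : vertex n) :
  (tperm x y * shift_perm d)%g = (shift_perm d * tperm (x + d) (y + d))%g.
Proof.
have := tpermJ x y (shift_perm d); rewrite !permE => <-.
by rewrite /conjg !mulgA mulgV mul1g.
Qed.

Lemma frame_stepN (n : nat) (d : vertex n) :
  frame_step (- d) = (frame_step d)^-1%g.
Proof.
rewrite /frame_step opprK invMg tpermV -shift_permN opprK tperm_shift.
by rewrite addNr add0r tpermC.
Qed.

Lemma frame_perm_cat (n : nat) (u v : seq (vertex n)) :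
  frame_perm (u ++ v) = (frame_perm u * frame_perm v)%g.
Proof. exact: big_cat. Qed.

Lemma frame_perm_rev (n : nat) (w : seq (vertex n)) :
  frame_perm (rev_word w) = (frame_perm w)^-1%g.
Proof.
elim: w => [|d w IH]; first by rewrite /frame_perm big_nil invg1.
rewrite /rev_word map_cons rev_cons -cats1 frame_perm_cat IH.
by rewrite /frame_perm big_seq1 big_cons invMg frame_stepN.
Qed.

Lemma sum_rev_word (n : nat) (w : seq (vertex n)) :
  \sum_(d <- rev_word w) d = - \sum_(d <- w) d.
Proof.
elim: w => [|d w IH]; first by rewrite !big_nil oppr0.
rewrite /rev_word map_cons rev_cons -cats1 big_cat big_seq1 IH big_cons.
by rewrite opprD addrC.
Qed.

Lemma oppr_directions (n : nat) (d : vertex n) :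
  d \in directions n -> - d \in directions n.
Proof.
have O (a b : 'Z_n) : - (a, b) = (- a, - b) :> vertex n by [].
by rewrite !inE => /or4P[] /eqP->; rewrite O !oppr0 ?opprK eqxx ?orbT.
Qed.

Lemma word_in_rev (n : nat) (w : seq (vertex n)) :
  word_in w -> word_in (rev_word w).
Proof.
move=> /allP win; rewrite /word_in /rev_word all_rev all_map.
by apply/allP => d /win; exact: oppr_directions.
Qed.

Lemma size_rev_word (n : nat) (w : seq (vertex n)) :
  size (rev_word w) = size w.
Proof. by rewrite size_rev size_map. Qed.

Lemma hole_moves (n : nat) (c : config n) (w : seq (vertex n)) :
  hole (moves c w) = hole c + \sum_(d <- w) d.
Proof.
elim: w c => [|d w IH] c; first by rewrite big_nil addr0.
by rewrite big_cons addrA -hole_move -IH.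
Qed.

(** [shift_perm (hole c) * c] is the configuration read from the hole: it sends an offset to the
    label found there. In this reading each move is a left multiplication independent of [c]. The
    inverse appears because the label now at an offset was formerly at its preimage. *)
Lemma moves_frame (n : nat) (c : config n) (w : seq (vertex n)) :
  (shift_perm (hole (moves c w)) * moves c w =
   (frame_perm w)^-1 * (shift_perm (hole c) * c))%g.
Proof.
elim: w c => [|d w IH] c; first by rewrite /frame_perm big_nil invg1 mul1g.
rewrite [moves c _]/= -/(moves _ _) IH /frame_perm big_cons invMg -mulgA.
congr (_ * _)%g; rewrite hole_move /move -frame_stepN /frame_step opprK.
rewrite !mulgA; congr (_ * _)%g.
rewrite -[RHS]mulgA shift_permD tperm_shift add0r addrA addNr add0r.
by rewrite tpermC addrC.
Qed.

Lemma moves_closed (n : nat) (c : config n) (w : seq (vertex n))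
    (s : {perm vertex n}) :
  \sum_(d <- w) d = 0 -> frame_perm w = s ->
  moves c w = ((s^-1) ^ shift_perm (hole c) * c)%g.
Proof.
move=> w0 <-; have := moves_frame c w; rewrite hole_moves w0 addr0.
by move=> /(canRL (mulKg _)) ->; rewrite conjgE !mulgA.
Qed.

Lemma frame_stepE (n : nat) (d x : vertex n) :
  frame_step d x = (if x == 0 then d else if x == d then 0 else x) - d.
Proof.
by rewrite permM permE; case: tpermP => [->|->|/eqP/negPf-> /eqP/negPf->];
  rewrite ?eqxx //; case: eqP => // ->.
Qed.

(* Concrete words are given by the cells that the hole visits, as pairs of
   naturals, so that their effect on a tile can be computed. *)
Definition cell (n : nat) (x : nat * nat) : vertex n := (x.1%:R, x.2%:R).

Fixpoint cell_word (n : nat) (p : nat * nat) (s : seq (nat * nat)) :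
    seq (vertex n) :=
  if s is q :: s' then (cell n q - cell n p) :: cell_word n q s' else [::].

Fixpoint track (p : nat * nat) (s : seq (nat * nat)) (x : nat * nat) :
    nat * nat :=
  if s is q :: s' then
    track q s' (if x == p then q else if x == q then p else x)
  else x.

Definition in_box (k : nat) (x : nat * nat) : bool :=
  (x.1 < k)%N && (x.2 < k)%N.

Definition adjacent (x y : nat * nat) : bool :=
  [|| y == (x.1.+1, x.2), x == (y.1.+1, y.2), y == (x.1, x.2.+1) |
      x == (y.1, y.2.+1)].

Lemma natZ_inj (n x y : nat) : (1 < n)%N -> (x < n)%N -> (y < n)%N ->
  (x%:R == y%:R :> 'Z_n) = (x == y).
Proof.
move=> n1 xn yn; apply/eqP/eqP => [|-> //] /(congr1 val).
by rewrite /= !val_Zp_nat // !modn_small.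
Qed.

Lemma cell_eq (n : nat) (x y : nat * nat) : (1 < n)%N -> in_box n x ->
  in_box n y -> (cell n x == cell n y) = (x == y).
Proof.
move=> n1 /andP[x1 x2] /andP[y1 y2].
by rewrite -!pair_eqE /= /pair_eq /= !natZ_inj.
Qed.

Lemma word_in_cell (n : nat) (p : nat * nat) (s : seq (nat * nat)) :
  path adjacent p s -> word_in (cell_word n p s).
Proof.
elim: s p => //= q s IH p /andP[pq /IH ->]; rewrite andbT.
have E (a b c d : 'Z_n) : (a, b) - (c, d) = (a - c, b - d) :> vertex n by [].
rewrite /cell E; case/or4P: pq => /eqP-> /=; rewrite !inE -natr1 ?subrr;
  by rewrite ?[_ + 1 - _]addrAC ?opprD ?addrA ?subrr ?add0r ?sub0r eqxx ?orbT.
Qed.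

Lemma sum_cell_word (n : nat) (p : nat * nat) (s : seq (nat * nat)) :
  \sum_(d <- cell_word n p s) d = cell n (last p s) - cell n p.
Proof.
elim: s p => [|q s IH] p /=; first by rewrite big_nil subrr.
by rewrite big_cons IH addrC addrA subrK.
Qed.

(** Inside the box [n] distinct cells are distinct vertices, so the computation on naturals is valid
    on the torus; offsets are recovered by subtracting the cell of the hole. *)
Lemma frame_cell_word (n : nat) (p : nat * nat) (s : seq (nat * nat))
    (x : nat * nat) :
  (1 < n)%N -> all (in_box n) (p :: s) -> in_box n x ->
  frame_perm (cell_word n p s) (cell n x - cell n p) =
  cell n (track p s x) - cell n (last p s).
Proof.
move=> n1; elim: s p x => [|q s IH] p x.
  by rewrite /frame_perm big_nil perm1.
rewrite [cell_word _ _ _]/= [all _ _]/= => /andP[pn qs] xn.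
have /andP[qn _] := qs.
rewrite /frame_perm big_cons permM frame_stepE subr_eq0 cell_eq //.
rewrite (inj_eq (@addIr _ _)) cell_eq // -/(frame_perm _).
rewrite -IH //; last by case: ifP => _ //; case: ifP.
congr (frame_perm _ _); case: ifP => _; first by rewrite !subrr.
by case: ifP => _; rewrite ?sub0r opprB // addrA subrK.
Qed.

Lemma frame_cell_word_fix (n : nat) (p : nat * nat) (s : seq (nat * nat))
    (t : vertex n) :
  t \notin map (cell n) (p :: s) ->
  frame_perm (cell_word n p s) (t - cell n p) = t - cell n (last p s).
Proof.
elim: s p => [|q s IH] p; first by rewrite /frame_perm big_nil perm1.
rewrite [cell_word _ _ _]/= map_cons inE negb_or => /andP[tp tq].
rewrite /frame_perm big_cons permM frame_stepE subr_eq0 (negPf tp).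
rewrite (inj_eq (@addIr _ _)) -/(frame_perm _).
case: eqP tq => [->|_ tq]; first by rewrite map_cons inE eqxx.
by rewrite opprB addrA subrK IH.
Qed.

(* The loop acts as a 3-cycle on the tiles at (1, 0), (0, 1) and (1, 1). The
   trains translate the hole together with the tiles at (1, 0) and (0, 1),
   staying in two rows or two columns. The corner word takes the tile at (1, 1)
   to (2, 2) and puts the hole and those two tiles back. *)
Notation loop_cells := [:: (1, 0); (1, 1); (0, 1); (0, 0)]%N.
Notation xtrain_cells :=
  [:: (0, 1); (1, 1); (2, 1); (2, 0); (1, 0); (0, 0); (0, 1); (1, 1); (1, 0)]%N.
Notation ytrain_cells :=
  [:: (1, 0); (1, 1); (1, 2); (0, 2); (0, 1); (0, 0); (1, 0); (1, 1); (0, 1)]%N.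
Notation corner_cells :=
  [:: (1, 0); (2, 0); (2, 1); (1, 1); (1, 2); (2, 2); (2, 1); (1, 1); (1, 0);
      (0, 0)]%N.

Lemma cell0 (n : nat) : cell n (0, 0)%N = 0. Proof. by []. Qed.

Lemma cellD (n a b c d : nat) :
  cell n (a + c, b + d)%N = cell n (a, b) + cell n (c, d).
Proof. by rewrite /cell /= !natrD. Qed.

Lemma cellMn (n a b k : nat) : cell n (a, b) *+ k = cell n (a * k, b * k)%N.
Proof.
elim: k => [|k IH]; first by rewrite !muln0.
by rewrite mulrS IH -cellD !mulnS.
Qed.

Lemma frame_track0 (n : nat) (s : seq (nat * nat)) (x : nat * nat) :
  (1 < n)%N -> all (in_box n) ((0, 0)%N :: s) -> in_box n x ->
  frame_perm (cell_word n (0, 0)%N s) (cell n x) =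
  cell n (track (0, 0)%N s x) - cell n (last (0, 0)%N s).
Proof.
by move=> n1 sn xn; rewrite -frame_cell_word // cell0 subr0.
Qed.

Lemma in_box_leq (k n : nat) (x : nat * nat) : (k <= n)%N ->
  in_box k x -> in_box n x.
Proof. by move=> kn /andP[h1 h2]; rewrite /in_box !(leq_trans _ kn). Qed.

Lemma frame_loop (n : nat) : (1 < n)%N ->
  frame_perm (cell_word n (0, 0)%N loop_cells) =
  (tperm (cell n (1, 0)%N) (cell n (0, 1)%N) *
   tperm (cell n (1, 0)%N) (cell n (1, 1)%N))%g.
Proof.
move=> n1.
have box x : in_box 2 x -> in_box n x by exact: in_box_leq.
have sn : all (in_box n) ((0, 0)%N :: loop_cells).
  by apply/allP => x xs; apply: box; move: x xs; apply/allP.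
have E x y : in_box 2 x -> in_box 2 y -> (cell n x == cell n y) = (x == y).
  by move=> hx hy; rewrite cell_eq // box.
apply/permP => t; rewrite permM.
have [tc|tc] := boolP (t \in map (cell n) ((0, 0)%N :: loop_cells)).
  have {tc} : t \in map (cell n) [:: (0, 0); (1, 0); (1, 1); (0, 1)]%N.
    by move: tc; rewrite !inE => /or4P[||| /orP[]] ->; rewrite ?orbT.
  move=> /mapP[x xs ->].
  rewrite frame_track0 //; last by apply: box; move: x xs; apply/allP.
  rewrite subr0.
  move: xs; rewrite !inE => /or4P[] /eqP->; rewrite /=.
  - by rewrite !tpermD // E.
  - by rewrite tpermL tpermD // E.
  - by rewrite (@tpermD _ _ _ (cell n (1, 1)%N)) ?E // tpermR.
  - by rewrite tpermR tpermL.
have -> : t = t - cell n (0, 0)%N by rewrite cell0 subr0.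
rewrite frame_cell_word_fix // cell0 subr0.
move: tc; rewrite !inE !negb_or => /and4P[_ t1 t2 /andP[t3 _]].
by rewrite !tpermD // eq_sym.
Qed.

Lemma frame_xtrain (n : nat) (w := cell_word n (0, 0)%N xtrain_cells) :
  (2 < n)%N ->
  [/\ word_in w, frame_perm w (cell n (1, 0)%N) = cell n (1, 0)%N,
      frame_perm w (cell n (0, 1)%N) = cell n (0, 1)%N &
      forall t : vertex n, t.2 != 0 -> t.2 != 1 ->
        frame_perm w t = t - cell n (1, 0)%N].
Proof.
move=> n2; have n1 := ltnW n2.
have box x : in_box 3 x -> in_box n x by exact: in_box_leq.
have sn : all (in_box n) ((0, 0)%N :: xtrain_cells).
  by apply/allP => x xs; apply: box; move: x xs; apply/allP.
split; first exact: word_in_cell.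
- rewrite (frame_track0 n1 sn (box (1, 0)%N isT)) (cellD n 1 0 1 0).
  by rewrite addrK.
- rewrite (frame_track0 n1 sn (box (0, 1)%N isT)) (cellD n 0 1 1 0).
  by rewrite addrK.
move=> t t0 t1; rewrite -[in LHS](subr0 t) -(cell0 n).
rewrite frame_cell_word_fix //; apply/mapP => -[x xs tx].
have : x.2 \in [:: 0; 1]%N by move: x xs {tx}; apply/allP.
by rewrite !inE => /orP[] /eqP x2; move: t0 t1; rewrite tx /cell /= x2 eqxx.
Qed.

Lemma frame_ytrain (n : nat) (w := cell_word n (0, 0)%N ytrain_cells) :
  (2 < n)%N ->
  [/\ word_in w, frame_perm w (cell n (1, 0)%N) = cell n (1, 0)%N,
      frame_perm w (cell n (0, 1)%N) = cell n (0, 1)%N &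
      forall t : vertex n, t.1 != 0 -> t.1 != 1 ->
        frame_perm w t = t - cell n (0, 1)%N].
Proof.
move=> n2; have n1 := ltnW n2.
have box x : in_box 3 x -> in_box n x by exact: in_box_leq.
have sn : all (in_box n) ((0, 0)%N :: ytrain_cells).
  by apply/allP => x xs; apply: box; move: x xs; apply/allP.
split; first exact: word_in_cell.
- rewrite (frame_track0 n1 sn (box (1, 0)%N isT)) (cellD n 1 0 0 1).
  by rewrite addrK.
- rewrite (frame_track0 n1 sn (box (0, 1)%N isT)) (cellD n 0 1 0 1).
  by rewrite addrK.
move=> t t0 t1; rewrite -[in LHS](subr0 t) -(cell0 n).
rewrite frame_cell_word_fix //; apply/mapP => -[x xs tx].
have : x.1 \in [:: 0; 1]%N by move: x xs {tx}; apply/allP.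
by rewrite !inE => /orP[] /eqP x1; move: t0 t1; rewrite tx /cell /= x1 eqxx.
Qed.

Lemma frame_corner (n : nat) (w := cell_word n (0, 0)%N corner_cells) :
  (2 < n)%N ->
  [/\ word_in w, frame_perm w (cell n (1, 0)%N) = cell n (1, 0)%N,
      frame_perm w (cell n (0, 1)%N) = cell n (0, 1)%N &
      frame_perm w (cell n (1, 1)%N) = cell n (2, 2)%N].
Proof.
move=> n2; have n1 := ltnW n2.
have box x : in_box 3 x -> in_box n x by exact: in_box_leq.
have sn : all (in_box n) ((0, 0)%N :: corner_cells).
  by apply/allP => x xs; apply: box; move: x xs; apply/allP.
split; first exact: word_in_cell.
- by rewrite (frame_track0 n1 sn (box (1, 0)%N isT)) subr0.
- by rewrite (frame_track0 n1 sn (box (0, 1)%N isT)) subr0.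
- by rewrite (frame_track0 n1 sn (box (1, 1)%N isT)) subr0.
Qed.

Lemma frame_perm_iter (n k : nat) (w : seq (vertex n)) :
  frame_perm (flatten (nseq k w)) = (frame_perm w ^+ k)%g.
Proof.
elim: k => [|k IH]; first by rewrite /frame_perm big_nil.
by rewrite [flatten _]/= frame_perm_cat IH expgS.
Qed.

Lemma word_in_cat (n : nat) (u v : seq (vertex n)) :
  word_in (u ++ v) = word_in u && word_in v.
Proof. exact: all_cat. Qed.

Lemma word_in_iter (n k : nat) (w : seq (vertex n)) :
  word_in w -> word_in (flatten (nseq k w)).
Proof. by move=> win; elim: k => //= k IH; rewrite word_in_cat win. Qed.

Lemma size_iter_word (n k : nat) (w : seq (vertex n)) :
  size (flatten (nseq k w)) = (k * size w)%N.
Proof. by elim: k => //= k IH; rewrite size_cat IH mulSn. Qed.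

Lemma expg_fix (T : finType) (s : {perm T}) (x : T) (k : nat) :
  s x = x -> (s ^+ k)%g x = x.
Proof. by move=> sx; elim: k => [|k IH]; rewrite ?perm1 // expgS permM sx. Qed.

Lemma natrZ (n : nat) : (1 < n)%N -> n%:R = 0 :> 'Z_n.
Proof. by move=> n1; apply: val_inj; rewrite /= val_Zp_nat // modnn. Qed.

Lemma iter_translate (n k : nat) (s : {perm vertex n}) (d t : vertex n)
    (P : pred (vertex n)) :
  (forall x, P x -> s x = x - d /\ P (x - d)) -> P t ->
  (s ^+ k)%g t = t - d *+ k.
Proof.
move=> sP; elim: k t => [|k IH] t Pt; first by rewrite perm1 mulr0n subr0.
have [st Pt'] := sP t Pt.
by rewrite expgS permM st IH // mulrS opprD addrA.
Qed.

(** The tile has to travel [x - 2] units. Adding [n], which is zero in ['Z_n], avoids the truncated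
    subtraction when [x < 2]. *)
Lemma xtrain_iter (n x y : nat) : (2 < n)%N -> (1 < y < n)%N ->
  (frame_perm (cell_word n (0, 0)%N xtrain_cells) ^+ (x + n - 2))%g
    (cell n (x, y)) = cell n (2, y)%N.
Proof.
move=> n2 /andP[y1 yn]; have n1 := ltnW n2.
have [_ _ _ X] := frame_xtrain n2.
rewrite (@iter_translate _ _ _ (cell n (1, 0)%N) _
  (fun t => (t.2 != 0) && (t.2 != 1))).
- rewrite cellMn mul0n mul1n; apply/eqP; rewrite subr_eq -cellD addn0.
  rewrite subnKC; last by lia.
  by rewrite /cell /= natrD natrZ // addr0.
- by move=> t /andP[t0 t1]; rewrite X //= subr0 t0.
by rewrite /= (natZ_inj (y := 0)) ?(natZ_inj (y := 1)) //; lia.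
Qed.

Lemma ytrain_iter (n x y : nat) : (2 < n)%N -> (1 < x < n)%N ->
  (frame_perm (cell_word n (0, 0)%N ytrain_cells) ^+ (y + n - 2))%g
    (cell n (x, y)) = cell n (x, 2)%N.
Proof.
move=> n2 /andP[x1 xn]; have n1 := ltnW n2.
have [_ _ _ Y] := frame_ytrain n2.
rewrite (@iter_translate _ _ _ (cell n (0, 1)%N) _
  (fun t => (t.1 != 0) && (t.1 != 1))).
- rewrite cellMn mul0n mul1n; apply/eqP; rewrite subr_eq -cellD addn0.
  rewrite subnKC; last by lia.
  by rewrite /cell /= natrD natrZ // addr0.
- by move=> t /andP[t0 t1]; rewrite Y //= subr0 t0.
by rewrite /= (natZ_inj (y := 0)) ?(natZ_inj (y := 1)) //; lia.
Qed.

(** A train translates exactly only the tiles off its two lines. The train whose lines miss [t] is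
    run until one coordinate is 2, which puts the tile off the lines of the other train; that one
    brings it to [(2, 2)], and the reversed corner word to [(1, 1)]. *)
Lemma word_to_corner (n : nat) (t : vertex n) : (1 < n)%N -> t != 0 ->
  t != cell n (1, 0)%N -> t != cell n (0, 1)%N ->
  exists w : seq (vertex n),
    [/\ word_in w, (size w <= 46 * n)%N,
        frame_perm w (cell n (1, 0)%N) = cell n (1, 0)%N,
        frame_perm w (cell n (0, 1)%N) = cell n (0, 1)%N &
        frame_perm w t = cell n (1, 1)%N].
Proof.
move=> n1 t0 ta tb.
have nE : n = (Zp_trunc n).+2 by rewrite Zp_cast.
have xn : (t.1 < n)%N by rewrite [ltnRHS]nE.
have yn : (t.2 < n)%N by rewrite [ltnRHS]nE.
have tE : t = cell n (nat_of_ord t.1, nat_of_ord t.2).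
  by rewrite /cell /= !natr_Zp -surjective_pairing.
move: (nat_of_ord t.1) (nat_of_ord t.2) xn yn tE => x y xn yn tE.
(* Here only [(1, 1)] is left, and the empty list does. This covers [n = 2], where the trains have
   no room. *)
have [/andP[x2 y2]|xy2] := boolP ((x < 2)%N && (y < 2)%N).
  have tc : t = cell n (1, 1)%N.
    move: t0 ta tb; rewrite tE; case: x x2 {xn tE} => [|[]] //.
      by case: y y2 {yn} => [|[]] //; rewrite eqxx.
    by case: y y2 {yn} => [|[]] //; rewrite eqxx.
  by exists [::]; rewrite /frame_perm big_nil !perm1.
have n2 : (2 < n)%N by lia.
have [Xw Xa Xb _] := frame_xtrain n2.
have [Yw Ya Yb _] := frame_ytrain n2.
have [Uw Ua Ub Ut] := frame_corner n2.
set X := cell_word n _ xtrain_cells in Xw Xa Xb.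
set Y := cell_word n _ ytrain_cells in Yw Ya Yb.
set U := cell_word n _ corner_cells in Uw Ua Ub Ut.
have inv v u : frame_perm U v = u -> frame_perm (rev_word U) u = v.
  by move=> <-; rewrite frame_perm_rev permK.
pose wx i := flatten (nseq i X); pose wy i := flatten (nseq i Y).
have fix_x i v : frame_perm X v = v -> frame_perm (wx i) v = v.
  by move=> h; rewrite frame_perm_iter expg_fix.
have fix_y i v : frame_perm Y v = v -> frame_perm (wy i) v = v.
  by move=> h; rewrite frame_perm_iter expg_fix.
have [y2|y2] := leqP 2 y.
  exists (wx (x + n - 2)%N ++ wy (y + n - 2)%N ++ rev_word U); split.
  - by rewrite !word_in_cat !word_in_iter // word_in_rev.
  - by rewrite !size_cat !size_iter_word size_rev_word /=; lia.
  - by rewrite !frame_perm_cat !permM fix_x // fix_y // (inv _ _ Ua).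
  - by rewrite !frame_perm_cat !permM fix_x // fix_y // (inv _ _ Ub).
  rewrite !frame_perm_cat !permM tE !frame_perm_iter xtrain_iter ?y2 //.
  by rewrite ytrain_iter // (inv _ _ Ut).
have x2 : (1 < x)%N by lia.
exists (wy (y + n - 2)%N ++ wx (x + n - 2)%N ++ rev_word U); split.
- by rewrite !word_in_cat !word_in_iter // word_in_rev.
- by rewrite !size_cat !size_iter_word size_rev_word /=; lia.
- by rewrite !frame_perm_cat !permM fix_y // fix_x // (inv _ _ Ua).
- by rewrite !frame_perm_cat !permM fix_y // fix_x // (inv _ _ Ub).
rewrite !frame_perm_cat !permM tE !frame_perm_iter ytrain_iter ?x2 //.
by rewrite xtrain_iter // (inv _ _ Ut).
Qed.

Lemma sum_word_cat (n : nat) (u v : seq (vertex n)) :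
  \sum_(d <- u ++ v) d = \sum_(d <- u) d + \sum_(d <- v) d.
Proof. exact: big_cat. Qed.

(** The loop is conjugated by a list bringing [t] to [(1, 1)]. That list may displace the hole, but
    its reverse undoes the displacement. The length is at most [2 * 46 * n + 4 <= 94 * n]. *)
Lemma three_cycle_word (n : nat) (t : vertex n) : (1 < n)%N -> t != 0 ->
  t != cell n (1, 0)%N ->
  exists w : seq (vertex n),
    [/\ word_in w, (size w <= 94 * n)%N, \sum_(d <- w) d = 0 &
        frame_perm w = (tperm (cell n (1, 0)%N) (cell n (0, 1)%N) *
                        tperm (cell n (1, 0)%N) t)%g].
Proof.
move=> n1 t0 ta.
have [->|tb] := eqVneq t (cell n (0, 1)%N).
  by exists [::]; rewrite big_nil /frame_perm big_nil tperm2.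
have [v [vin vs va vb vt]] := word_to_corner n1 t0 ta tb.
exists (v ++ cell_word n (0, 0)%N loop_cells ++ rev_word v); split.
- rewrite !word_in_cat vin (word_in_rev vin) andbT.
  by rewrite word_in_cell.
- by rewrite !size_cat size_rev_word /=; lia.
- by rewrite !sum_word_cat sum_rev_word sum_cell_word subrr add0r subrr.
rewrite !frame_perm_cat frame_perm_rev frame_loop //.
have <- : ((tperm (cell n (1, 0)%N) (cell n (0, 1)%N) *
    tperm (cell n (1, 0)%N) t) ^ frame_perm v =
    tperm (cell n (1, 0)%N) (cell n (0, 1)%N) *
    tperm (cell n (1, 0)%N) (cell n (1, 1)%N))%g.
  by rewrite conjMg !tpermJ va vb vt.
by rewrite conjgE !mulgA mulgV mul1g mulgK.
Qed.

Lemma tperm_pair_word (n : nat) (i j : vertex n) : (1 < n)%N ->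
  i != 0 -> j != 0 -> i != j ->
  exists w : seq (vertex n),
    [/\ word_in w, (size w <= 300 * n)%N &
        forall c, moves c w =
          (tperm (cell n (1, 0)%N + hole c)%R (cell n (0, 1)%N + hole c)%R *
           (tperm (i + hole c)%R (j + hole c)%R * c))%g].
Proof.
move=> n1 i0 j0 ij; set a := cell n (1, 0)%N; set b := cell n (0, 1)%N.
suff [w [win ws w0 wE]] : exists w : seq (vertex n),
    [/\ word_in w, (size w <= 300 * n)%N, \sum_(d <- w) d = 0 &
        frame_perm w = (tperm a b * tperm i j)%g].
  exists (rev_word w); split; first exact: word_in_rev.
    by rewrite size_rev_word.
  move=> c; rewrite (@moves_closed _ _ _ (tperm a b * tperm i j)^-1%g).
  - by rewrite invgK conjMg !tpermJ !permE mulgA.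
  - by rewrite sum_rev_word w0 oppr0.
  - by rewrite frame_perm_rev wE.
have [ia|ia] := eqVneq i a.
  have ja : j != a by rewrite -ia eq_sym.
  have [w [win ws w0 wE]] := three_cycle_word n1 j0 ja.
  by exists w; split; rewrite ?ia //; lia.
have [ja|ja] := eqVneq j a.
  have [w [win ws w0 wE]] := three_cycle_word n1 i0 ia.
  by exists w; split; rewrite ?ja 1?(tpermC i) //; lia.
have [u [uin us u0 uE]] := three_cycle_word n1 i0 ia.
have [v [vin vs v0 vE]] := three_cycle_word n1 j0 ja.
(* In the product of the three frames two copies of [tperm a b] cancel, leaving [tperm a b] times
   [tperm a i * tperm a j * tperm a i], which is [tperm i j]. *)
exists (u ++ rev_word v ++ u); split.
- by rewrite !word_in_cat uin word_in_rev.
- by rewrite !size_cat size_rev_word; lia.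
- by rewrite !sum_word_cat sum_rev_word u0 v0 oppr0 !addr0.
rewrite !frame_perm_cat frame_perm_rev uE vE -/a -/b invMg !tpermV !mulgA.
rewrite -(mulgA _ (tperm a b) (tperm a b)) tperm2 mulg1.
have aj : a != j by rewrite eq_sym.
have := tpermJ a j (tperm a i); rewrite tpermL (tpermD aj ij).
by rewrite conjgE tpermV => <-; rewrite !mulgA.
Qed.

Lemma sum_nseq (n k : nat) (d : vertex n) : \sum_(x <- nseq k d) x = d *+ k.
Proof. by rewrite big_nseq iter_addr addr0. Qed.

(** For odd [n] the two ways around the torus, [x] steps forward or [n - x] backward, have lengths
    of opposite parity. Displacement and parity can then be prescribed independently. *)
Lemma walk_word (n : nat) (s : vertex n) (e : bool) : (1 < n)%N ->
  exists w : seq (vertex n),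
    [/\ word_in w, (size w <= 300 * n)%N, \sum_(d <- w) d = s &
        odd n -> odd (size w) = e].
Proof.
move=> n1; have nE : n = (Zp_trunc n).+2 by rewrite Zp_cast.
have xn : (s.1 < n)%N by rewrite [ltnRHS]nE.
have yn : (s.2 < n)%N by rewrite [ltnRHS]nE.
have sE : s = cell n (nat_of_ord s.1, nat_of_ord s.2).
  by rewrite /cell /= !natr_Zp -surjective_pairing.
move: (nat_of_ord s.1) (nat_of_ord s.2) xn yn sE => x y xn yn ->.
have w1 k d : d \in directions n -> word_in (nseq k d).
  by move=> hd; rewrite /word_in all_nseq /= hd orbT.
have d1 : cell n (1, 0)%N \in directions n by rewrite inE eqxx.
have d2 : cell n (0, 1)%N \in directions n by rewrite !inE eqxx !orbT.
have [odd_xy|even_xy] := eqVneq (odd (x + y)) e.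
  exists (nseq x (cell n (1, 0)%N) ++ nseq y (cell n (0, 1)%N)); split.
  - by rewrite word_in_cat !w1.
  - by rewrite size_cat !size_nseq; lia.
  - rewrite sum_word_cat !sum_nseq !cellMn -cellD.
    by rewrite !mul0n !mul1n addn0.
  - by rewrite size_cat !size_nseq.
exists (nseq (n - x) (- cell n (1, 0)%N) ++ nseq y (cell n (0, 1)%N)); split.
- by rewrite word_in_cat !w1 // oppr_directions.
- by rewrite size_cat !size_nseq; lia.
- rewrite sum_word_cat !sum_nseq mulNrn !cellMn !mul0n !mul1n.
  rewrite -(add0n y) -[in RHS](addn0 x) cellD add0n; congr (_ + _).
  apply/eqP; rewrite eq_sym -subr_eq0 opprK -cellD subnKC; last exact: ltnW.
  by rewrite /cell /= natrZ.
move=> nodd; move: even_xy; rewrite size_cat !size_nseq !oddD.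
rewrite oddB; last exact: ltnW.
by rewrite nodd; case: (odd x); case: (odd y); case: e.
Qed.

(** * Lists as bijections of the state space, and the Dirichlet form *)

Lemma moves_rev (n : nat) (c : config n) (w : seq (vertex n)) :
  moves (moves c w) (rev_word w) = c.
Proof.
elim: w c => // d w IH c.
rewrite /rev_word map_cons rev_cons -cats1 /moves foldl_cat.
by rewrite [foldl _ _ (d :: w)]/= -/(moves _ w) -/(moves _ (rev _)) IH /= moveK.
Qed.

Lemma moves_inj (n : nat) (w : seq (vertex n)) :
  injective (fun c : config n => moves c w).
Proof. by move=> c1 c2 h; rewrite -(moves_rev c1 w) h moves_rev. Qed.

Lemma moves_loyd_space (n : nat) (c : config n) (w : seq (vertex n)) :
  (1 < n)%N -> word_in w ->
  (moves c w \in loyd_space n) = (c \in loyd_space n).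
Proof.
move=> n1; elim: w c => // d w IH c /andP[hd hw].
by rewrite [moves _ _]/= -/(moves _ _) IH // move_loyd_space.
Qed.

Lemma direction_neq0 (n : nat) (d : vertex n) : (1 < n)%N ->
  d \in directions n -> d != 0.
Proof.
move=> n1; have h : (1 : 'Z_n) != 0 by exact: oner_neq0.
by rewrite !inE -!pair_eqE /pair_eq /= => /or4P[] /andP[/eqP-> /eqP->];
  rewrite ?oppr_eq0 (negPf h) ?andbF.
Qed.

Lemma odd_moves (n : nat) (c : config n) (w : seq (vertex n)) :
  (1 < n)%N -> word_in w ->
  odd_perm (moves c w) = odd_perm c (+) odd (size w).
Proof.
move=> n1; elim: w c => [|d w IH] c; first by rewrite addbF.
move=> /andP[hd hw]; rewrite [moves _ _]/= -/(moves _ _) IH //.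
rewrite odd_permM odd_tperm -subr_eq0 opprD addrA subrr sub0r oppr_eq0.
by rewrite direction_neq0 //=; case: odd_perm; case: (odd _).
Qed.

(** The Dirichlet form without stationary weight or step probabilities, to match the unnormalised
    [ent]. *)
Definition energy (R : realType) (n : nat) (f : config n -> R) : R :=
  \sum_(c in loyd_space n) \sum_(d <- directions n) (f c - f (move c d)) ^+ 2.

Lemma energy_ge0 (R : realType) (n : nat) (f : config n -> R) :
  0 <= energy f.
Proof.
by apply: sumr_ge0 => c _; apply: sumr_ge0 => d _; exact: sqr_ge0.
Qed.

Lemma sum_loyd_moves (R : realType) (n : nat) (w : seq (vertex n))
    (g : config n -> R) : (1 < n)%N -> word_in w ->
  \sum_(c in loyd_space n) g (moves c w) = \sum_(c in loyd_space n) g c.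
Proof.
move=> n1 win; rewrite [RHS](reindex_inj (@moves_inj n w)) /=.
by apply: eq_bigl => c; rewrite moves_loyd_space.
Qed.

(* For a fixed word, [c] |-> [moves c w] is a bijection of the state space, so
   that each step of the path contributes at most [energy f]. *)
Lemma sum_moves_energy (R : realType) (n : nat) (w : seq (vertex n))
    (f : config n -> R) : (1 < n)%N -> word_in w ->
  \sum_(c in loyd_space n) (f c - f (moves c w)) ^+ 2 <=
  (size w)%:R ^+ 2 * energy f.
Proof.
move=> n1; elim/last_ind: w => [|w d IH] win.
  rewrite big1 ?mulr_ge0 ?sqr_ge0 ?energy_ge0 // => c _.
  by rewrite subrr expr0n.
move: win; rewrite /word_in all_rcons => /andP[hd hw].
have stepE : \sum_(c in loyd_space n)
    (f (moves c w) - f (moves c (rcons w d))) ^+ 2 <= energy f.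
  under eq_bigr do rewrite /moves foldl_rcons -/(moves _ _).
  rewrite (sum_loyd_moves (fun c => (f c - f (move c d)) ^+ 2)) //.
  apply: ler_sum => c _; rewrite (big_rem d) //= lerDl.
  by apply: sumr_ge0 => x _; exact: sqr_ge0.
have [w0|w0] := posnP (size w).
  move: stepE; rewrite (size0nil w0) /= expr1n mul1r.
  exact.
have {}IH := IH hw; set k : R := (size w)%:R in IH.
have k0 : 0 < k by rewrite ltr0n.
(* The weights satisfy [(1 + k^-1) * k ^+ 2 + (1 + k) = (k + 1) ^+ 2], exactly the bound for one
   more move. *)
apply: (@le_trans _ _ (\sum_(c in loyd_space n)
    ((1 + k^-1) * (f c - f (moves c w)) ^+ 2 +
     (1 + k) * (f (moves c w) - f (moves c (rcons w d))) ^+ 2))).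
  apply: ler_sum => c _.
  move: (f c) (f (moves c w)) (f (moves _ _)) => x y z.
  have -> : (1 + k^-1) * (x - y) ^+ 2 + (1 + k) * (y - z) ^+ 2 =
    (x - z) ^+ 2 + k^-1 * ((x - y) - k * (y - z)) ^+ 2.
    by field; rewrite gt_eqF.
  by rewrite lerDl mulr_ge0 ?sqr_ge0 // invr_ge0 ltW.
rewrite big_split -!mulr_sumr size_rcons -natr1 -/k.
have kV : 0 <= k^-1 by rewrite invr_ge0 ltW.
apply: le_trans (lerD (ler_wpM2l (addr_ge0 ler01 kV) IH)
  (ler_wpM2l (addr_ge0 ler01 (ltW k0)) stepE)) _.
rewrite le_eqVlt; apply/orP; left; apply/eqP.
by field; rewrite gt_eqF.
Qed.

Definition config_class (n : nat) (h : vertex n) (e : bool) : {set config n} :=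
  [set c | (hole c == h) && (odd_perm c == e)].

Lemma perm_on_compl1 (T : finType) (h : T) (s : {perm T}) :
  perm_on [set~ h] s = (s h == h).
Proof.
apply/idP/eqP => [sh|sh]; first by rewrite (out_perm sh) // !inE eqxx.
apply/fintype.subsetP => x; rewrite !inE; apply: contraNneq => ->.
by rewrite sh eqxx.
Qed.

(* The chain moves between configurations of equal parity, while [ent_perm_on]
   compares configurations that differ by one transposition of tiles: composing
   the odd permutations with a fixed transposition reconciles the two. *)
Lemma ent_config_class (R : realType) (n : nat) (h : vertex n) (e : bool)
    (L : R) (f : config n -> R) (a b : vertex n) :
  ln #|[set~ (0 : vertex n)]|%:R <= L -> 0 <= L ->
  a != 0 -> b != 0 -> a != b ->
  ent (config_class h e) (fun c => f c ^+ 2) <=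
  (5 + 8 * L) / #|[set~ (0 : vertex n)]|%:R *
  \sum_(i in [set~ (0 : vertex n)]) \sum_(j in [set~ (0 : vertex n)] | i != j)
    \sum_(c in config_class h e)
      (f c - f (tperm (a + hole c)%R (b + hole c)%R *
                (tperm (i + hole c)%R (j + hole c)%R * c))%g) ^+ 2.
Proof.
move=> lnL L0 a0 b0 ab.
have [->|[c0]] := set_0Vmem (config_class h e).
  rewrite ent_le1 ?cards0 // mulr_ge0 ?divr_ge0 ?addr_ge0 ?mulr_ge0 //.
  apply: sumr_ge0 => i _; apply: sumr_ge0 => j _; apply: sumr_ge0 => c _.
  exact: sqr_ge0.
rewrite inE => /andP[/eqP hc0 /eqP oc0].
set tab := tperm (a + h)%R (b + h)%R.
have ab' : a + h != b + h by rewrite (inj_eq (@addIr _ h)).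
have neh x : x != 0 -> x + h != h.
  by move=> x0; rewrite -{2}(add0r h) (inj_eq (@addIr _ h)).
(* A two-to-one map from the permutations fixing [h] onto the class, based at an arbitrary member
   [c0]. *)
pose phi (s : {perm vertex n}) := ((if odd_perm s then tab * s else s) * c0)%g.
have hole_phi (s : {perm vertex n}) : (hole (s * c0)%g == h) = (s h == h).
  rewrite /hole invMg permM -/(hole c0) hc0; apply/eqP/eqP => sh.
    by rewrite -{1}sh permKV.
  by rewrite -{1}sh permK.
have even_sum (w : config n -> R) :
    \sum_(s | perm_on [set~ h] s && ~~ odd_perm s) w (s * c0)%g =
    \sum_(c in config_class h e) w c.
  rewrite [RHS](reindex_inj (mulIg c0)) /=; apply: eq_bigl => s.
  rewrite inE hole_phi perm_on_compl1 odd_permM oc0; congr (_ && _).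
  by case: (odd_perm s); case: (e).
have flip i j (w : {perm vertex n} -> R) : i != 0 -> j != 0 -> i != j ->
    \sum_(s | perm_on [set~ h] s && odd_perm s)
      w (tperm (i + h)%R (j + h)%R * s)%g =
    \sum_(s | perm_on [set~ h] s && ~~ odd_perm s) w s.
  move=> i0 j0 ij.
  rewrite [RHS](reindex_inj (mulgI (tperm (i + h)%R (j + h)%R))) /=.
  apply: eq_bigl => s; rewrite !perm_on_compl1 odd_permM odd_tperm permM.
  by rewrite (inj_eq (@addIr _ h)) ij tpermD ?neh //= negbK.
have phi_sum (w : config n -> R) :
    \sum_(s in [set s | perm_on [set~ h] s]) w (phi s) =
    2%:R * \sum_(c in config_class h e) w c.
  rewrite (eq_bigl (perm_on [set~ h])) => [|s]; last by rewrite inE.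
  rewrite (bigID (fun s : {perm vertex n} => odd_perm s)) /=.
  rewrite (eq_bigr (fun s => w (tab * s * c0)%g)); last first.
    by move=> s /andP[_ os]; rewrite /phi os.
  rewrite (flip a b (fun s => w (s * c0)%g)) // even_sum.
  rewrite [X in _ + X](eq_bigr (fun s => w (s * c0)%g)); last first.
    by move=> s /andP[_ /negPf os]; rewrite /phi os.
  by rewrite even_sum mulr_natl mulr2n.
have cA : #|[set~ h]| = #|[set~ (0 : vertex n)]| by rewrite !cardsC1.
rewrite -(ler_pM2l (_ : 0 < 2%:R :> R)) //.
rewrite -(@ent_cover _ _ _ [set s | perm_on [set~ h] s] _ phi) //.
have := @ent_perm_on R _ [set~ h] L (f \o phi).
rewrite cA => /(_ lnL L0) /le_trans; apply.
rewrite mulrCA ler_wpM2l ?divr_ge0 ?addr_ge0 ?mulr_ge0 //.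
rewrite (reindex_inj (@addIr _ h)) /=.
rewrite (eq_bigl (mem [set~ (0 : vertex n)])) => [|i]; last first.
  by rewrite !inE -subr_eq0 addrK.
rewrite mulr_sumr; apply: ler_sum => i; rewrite !inE => i0.
rewrite (reindex_inj (@addIr _ h)) /=.
rewrite (eq_bigl (mem [set~ (0 : vertex n)])) => [|j]; last first.
  by rewrite !inE -subr_eq0 addrK.
rewrite [leLHS](bigID (fun j => i != j)) /=.
rewrite [X in _ + X]big1 ?addr0 => [|j /andP[_ /negPn/eqP ->]]; last first.
  by apply: big1 => s _; rewrite tperm1 mul1g subrr expr0n.
rewrite mulr_sumr; apply: ler_sum => j /andP[]; rewrite !inE => j0 ij.
set tij := tperm (i + h)%R (j + h)%R.
pose D c := (f c - f (tab * (tij * c))%g) ^+ 2.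
have -> : \sum_(c in config_class h e) (f c -
    f (tperm (a + hole c)%R (b + hole c)%R *
      (tperm (i + hole c)%R (j + hole c)%R * c))%g) ^+ 2 =
    \sum_(c in config_class h e) D c.
  by apply: eq_bigr => c; rewrite inE => /andP[/eqP -> _].
have otij : odd_perm tij by rewrite odd_tperm (inj_eq (@addIr _ h)).
(* The odd and even halves give the same sum: multiplying an odd [s] by [tij] exchanges the two ends
   of the difference. The resulting 2 matches that of the double cover. *)
rewrite (bigID (fun s : {perm vertex n} => odd_perm s)) /=.
rewrite (eq_bigr (fun s => D (tij * s * c0)%g)); last first.
  move=> s /andP[_ os]; rewrite /phi /D odd_permM otij os /=.
  by rewrite !mulgA -[(tab * tij * tij)%g]mulgA tperm2 mulg1 -sqrrN opprB.
rewrite (flip i j (fun s => D (s * c0)%g)) //.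
rewrite [X in _ + X](eq_bigr (fun s => D (s * c0)%g)); last first.
  move=> s /andP[_ /negPf os]; rewrite /phi /D odd_permM otij os /=.
  by rewrite !mulgA.
by rewrite even_sum mulr_natl mulr2n.
Qed.

(** * The logarithmic Sobolev inequality of the chain *)

Definition loyd_classes (n : nat) : {set vertex n * bool} :=
  [set k | odd n || (k.2 == vertex_odd k.1)].

Definition class_of (n : nat) (c : config n) : vertex n * bool :=
  (hole c, odd_perm c).

Lemma class_of_loyd (n : nat) (c : config n) :
  (c \in loyd_space n) = (class_of c \in loyd_classes n).
Proof. by rewrite /loyd_space /loyd_classes !inE; case: odd; rewrite !inE. Qed.

Lemma loyd_space_fiber (n : nat) (k : vertex n * bool) :
  k \in loyd_classes n ->
  [set c in loyd_space n | class_of c == k] = config_class k.1 k.2.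
Proof.
move=> kI; apply/setP => c; rewrite !inE class_of_loyd.
have -> : (hole c == k.1) && (odd_perm c == k.2) = (class_of c == k).
  by rewrite -pair_eqE.
by case: eqP => [->|_]; rewrite ?andbF // kI.
Qed.

Lemma card_loyd_classes (n : nat) : (#|{: vertex n}| <= #|loyd_classes n|)%N.
Proof.
have inj : injective (fun h : vertex n => (h, vertex_odd h)) by move=> x y [].
rewrite -cardsT -(card_imset _ inj); apply: subset_leq_card.
by apply/fintype.subsetP => _ /imsetP[h _ ->]; rewrite inE eqxx orbT.
Qed.

Lemma card_vertex (n : nat) : (1 < n)%N -> #|{: vertex n}| = (n * n)%N.
Proof. by move=> n1; rewrite card_prod !card_ord Zp_cast. Qed.

Lemma sum_class_of (R : realType) (n : nat) (w : config n -> R) :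
  \sum_(k in loyd_classes n) \sum_(c in loyd_space n | class_of c == k) w c =
  \sum_(c in loyd_space n) w c.
Proof.
rewrite [RHS](partition_big (@class_of n) (mem (loyd_classes n))) //=.
by move=> c; rewrite class_of_loyd.
Qed.

(** The classes are joined by walks that depend only on the displacement and the change of parity.
    There are twice as many such pairs as vertices, and at least as many classes as vertices, whence
    the factor 2. *)
Lemma ent_loyd_classes (R : realType) (n : nat) (f : config n -> R) (L : R) :
  (1 < n)%N -> ln (#|{: vertex n}|.*2)%:R <= L ->
  ent (loyd_space n) (fun c => f c ^+ 2) <=
  \sum_(k in loyd_classes n) ent (config_class k.1 k.2) (fun c => f c ^+ 2) +
  (5 + 8 * L) * 2 * ((300 * n)%:R ^+ 2 * energy f).
Proof.
move=> n1 lnL.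
have N0 : (0 < #|{: vertex n}|)%N by rewrite card_vertex // muln_gt0 ltnW.
have L0 : 0 <= L by apply: le_trans lnL; rewrite ln_ge0 // ler1n double_gt0.
have B0 : 0 <= 5 + 8 * L by rewrite addr_ge0 ?mulr_ge0.
set q := (300 * n)%:R ^+ 2 * energy f.
have q0 : 0 <= q by apply: mulr_ge0 (sqr_ge0 _) (energy_ge0 f).
have [w wP] := choice (fun se : vertex n * bool =>
  walk_word se.1 se.2 n1).
pose phi (k l : vertex n * bool) (c : config n) :=
  moves c (w (l.1 - k.1, k.2 (+) l.2)).
have win se : word_in (w se) by have [] := wP se.
have phi_inj k l : injective (phi k l) by exact: moves_inj.
have phiP : {in loyd_classes n &, forall k l c, c \in loyd_space n ->
    class_of c = k -> phi k l c \in loyd_space n /\ class_of (phi k l c) = l}.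
  move=> k l kI lI c cO ck; have phiO : phi k l c \in loyd_space n.
    by rewrite moves_loyd_space.
  split=> //; have [_ _ ws wo] := wP (l.1 - k.1, k.2 (+) l.2).
  have hk : hole (phi k l c) = l.1.
    by rewrite hole_moves ws -ck /= addrC subrK.
  move: phiO; rewrite class_of_loyd inE /= hk; move: lI; rewrite inE.
  (* For even [n] the parity needs no control: the walk stays in the state space, where the hole
     determines it. *)
  case: (boolP (odd n)) => [nodd _ _|_ /= /eqP l2 /eqP o].
    rewrite /class_of hk odd_moves // wo //= -ck /=.
    by rewrite addKb -surjective_pairing.
  by rewrite /class_of hk o -l2 -surjective_pairing.
have [loyd0|[c0 c0O]] := set_0Vmem (loyd_space n).
  have card0 : (#|loyd_space n| <= 1)%N by rewrite loyd0 cards0.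
  rewrite (ent_le1 _ card0); apply: addr_ge0.
    apply: sumr_ge0 => k kI; rewrite -loyd_space_fiber // ent_le1 //.
    apply: leq_trans card0; apply: subset_leq_card.
    by apply/fintype.subsetP => c; rewrite inE => /andP[].
  by apply: mulr_ge0 q0; apply: mulr_ge0.
have k0I : class_of c0 \in loyd_classes n by rewrite -class_of_loyd.
pose fib k := [set c in loyd_space n | class_of c == k].
have fib_le k l : k \in loyd_classes n -> l \in loyd_classes n ->
    (#|fib k| <= #|fib l|)%N.
  move=> kI lI; rewrite -(card_imset _ (phi_inj k l)); apply: subset_leq_card.
  apply/fintype.subsetP => y /imsetP[c cfib ->].
  move: cfib; rewrite !inE => /andP[cO /eqP ck].
  by have [-> ->] := phiP k l kI lI c cO ck; rewrite eqxx.
apply: le_trans (@ent_blocks R _ _ (loyd_space n) (loyd_classes n) (@class_of n)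
  #|fib (class_of c0)| phi f _ _ _ _ _) _ => //.
- by apply/card_gt0P; exists c0; rewrite inE c0O eqxx.
- by move=> c; rewrite class_of_loyd.
- by move=> k kI; apply/eqP; rewrite eqn_leq !fib_le.
rewrite (eq_bigr (fun k : vertex n * bool =>
  ent (config_class k.1 k.2) (fun c => f c ^+ 2))); last first.
  by move=> k kI; rewrite loyd_space_fiber.
rewrite lerD2l.
have I0 : (0 < #|loyd_classes n|)%N by apply: leq_trans (card_loyd_classes n).
have I2 : (#|loyd_classes n| <= #|{: vertex n}|.*2)%N.
  by apply: leq_trans (max_card _) _; rewrite card_prod card_bool muln2.
apply: (@le_trans _ _ ((5 + 8 * L) / #|loyd_classes n|%:R *
    ((#|{: vertex n}|.*2)%:R * q))); last first.
  rewrite -!mulrA; apply: ler_wpM2l => //.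
  rewrite ler_pdivrMl ?ltr0n // [leRHS]mulrA -natrM ler_wpM2r // ler_nat.
  by rewrite -muln2 leq_mul2r card_loyd_classes orbT.
apply: ler_pM.
- by rewrite divr_ge0 // addr_ge0 // mulr_ge0 // ln_ge0 // ler1n.
- by do 3![apply: sumr_ge0 => ? _]; exact: sqr_ge0.
- rewrite ler_wpM2r ?invr_ge0 // lerD2l ler_wpM2l //.
  by apply: le_trans lnL; rewrite ler_ln ?posrE ?ltr0n ?double_gt0 ?ler_nat.
(* Reindexing by the difference of classes and allowing every difference fixes one list per term, so
   that the sum over [k] runs over the whole state space. *)
apply: (@le_trans _ _ (\sum_(k in loyd_classes n) \sum_(se : vertex n * bool)
    \sum_(c in loyd_space n | class_of c == k)
      (f c - f (moves c (w se))) ^+ 2)).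
  apply: ler_sum => k kI.
  have tr_inj : injective (fun l : vertex n * bool => (l.1 - k.1, k.2 (+) l.2)).
    move=> x y xy; have /= /addIr := congr1 fst xy.
    have /= /addbI := congr1 snd xy.
    by case: x y {xy} => [x1 x2] [y1 y2] /= -> ->.
  rewrite [leRHS](reindex_inj tr_inj) /=.
  rewrite [leRHS](bigID (mem (loyd_classes n))) /= lerDl.
  by do 2![apply: sumr_ge0 => ? _]; exact: sqr_ge0.
rewrite exchange_big /=.
apply: (@le_trans _ _ (\sum_(se : vertex n * bool) q)); last first.
  by rewrite sumr_const card_prod card_bool muln2 mulr_natl.
apply: ler_sum => se _; rewrite sum_class_of.
apply: le_trans (sum_moves_energy _ n1 (win se)) _.
apply: ler_wpM2r; first exact: energy_ge0.
have [_ ws _ _] := wP se.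
by apply: lerXn2r; rewrite ?nnegrE ?ler0n ?ler_nat.
Qed.

(** One list per pair [(i, j)] serves all classes, so a pair costs one multiple of the energy for
    all of them together. The [M] squared pairs, divided by [M], leave at most the number of
    vertices. *)
Lemma ent_config_classes (R : realType) (n : nat) (f : config n -> R) (L : R) :
  (1 < n)%N -> ln (#|{: vertex n}|)%:R <= L ->
  \sum_(k in loyd_classes n) ent (config_class k.1 k.2) (fun c => f c ^+ 2) <=
  (5 + 8 * L) * #|{: vertex n}|%:R * ((300 * n)%:R ^+ 2 * energy f).
Proof.
move=> n1 lnL.
have N1 : (1 < #|{: vertex n}|)%N.
  by rewrite card_vertex // (leq_trans n1) // leq_pmull // ltnW.
have M0 : (0 < #|[set~ (0%R : vertex n)]|)%N by rewrite cardsC1 -subn1 subn_gt0.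
have MN : (#|[set~ (0%R : vertex n)]| <= #|{: vertex n}|)%N by exact: max_card.
set M := #|[set~ (0 : vertex n)]| in M0 MN.
have lnM : ln (M%:R : R) <= L.
  by apply: le_trans lnL; rewrite ler_ln ?posrE ?ltr0n ?ler_nat // ltnW.
have L0 : 0 <= L by apply: le_trans lnM; rewrite ln_ge0 // ler1n.
have B0 : 0 <= 5 + 8 * L by rewrite addr_ge0 ?mulr_ge0.
set q := (300 * n)%:R ^+ 2 * energy f.
have q0 : 0 <= q by apply: mulr_ge0 (sqr_ge0 _) (energy_ge0 f).
set a := cell n (1, 0)%N; set b := cell n (0, 1)%N.
have box x : in_box 2 x -> in_box n x by exact: in_box_leq.
have a0 : a != 0 by rewrite -(cell0 n) cell_eq ?box.
have b0 : b != 0 by rewrite -(cell0 n) cell_eq ?box.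
have ab : a != b by rewrite cell_eq ?box.
apply: (@le_trans _ _ (\sum_(k in loyd_classes n) (5 + 8 * L) / M%:R *
  \sum_(i in [set~ (0 : vertex n)]) \sum_(j in [set~ (0 : vertex n)] | i != j)
    \sum_(c in config_class k.1 k.2)
      (f c - f (tperm (a + hole c)%R (b + hole c)%R *
                (tperm (i + hole c)%R (j + hole c)%R * c))%g) ^+ 2)).
  by apply: ler_sum => k _; exact: ent_config_class.
rewrite -mulr_sumr exchange_big /=.
apply: (@le_trans _ _ ((5 + 8 * L) / M%:R * (\sum_(i in [set~ (0 : vertex n)])
    \sum_(j in [set~ (0 : vertex n)]) q))); last first.
  have -> : \sum_(i in [set~ (0 : vertex n)])
      \sum_(j in [set~ (0 : vertex n)]) q = q * M%:R * M%:R.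
    by rewrite !sumr_const !mulr_natr.
  have -> : (5 + 8 * L) / M%:R * (q * M%:R * M%:R) = (5 + 8 * L) * M%:R * q.
    by field; rewrite pnatr_eq0 -lt0n.
  by rewrite ler_wpM2r // ler_wpM2l // ler_nat.
rewrite ler_wpM2l ?divr_ge0 //; apply: ler_sum => i; rewrite !inE => i0.
rewrite exchange_big /= big_mkcondr /=; apply: ler_sum => j; rewrite !inE => j0.
case: ifP => // ij.
have [w [win ws wE]] := tperm_pair_word n1 i0 j0 ij.
have -> : \sum_(k in loyd_classes n) \sum_(c in config_class k.1 k.2)
      (f c - f (tperm (a + hole c)%R (b + hole c)%R *
                (tperm (i + hole c)%R (j + hole c)%R * c))%g) ^+ 2 =
    \sum_(c in loyd_space n) (f c - f (moves c w)) ^+ 2.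
  rewrite -sum_class_of; apply: eq_bigr => k kI.
  rewrite -loyd_space_fiber // [LHS](eq_bigl (fun c => (c \in loyd_space n) &&
    (class_of c == k))) => [|c]; last by rewrite inE.
  by apply: eq_bigr => c _; rewrite wE.
apply: le_trans (sum_moves_energy _ n1 win) _.
apply: ler_wpM2r; first exact: energy_ge0.
by apply: lerXn2r; rewrite ?nnegrE ?ler0n ?ler_nat.
Qed.

Lemma loyd_log_sobolev (R : realType) (n : nat) (f : config n -> R) :
  (1 < n)%N ->
  ent (loyd_space n) (fun c => f c ^+ 2) <=
  68 * 300 ^+ 2 * n%:R ^+ 4 * ln n%:R * energy f.
Proof.
move=> n1; have x0 : 2 <= (n%:R : R) by rewrite ler_nat.
have xp : 0 < (n%:R : R) by lra.
have ln2 : 2^-1 <= ln (n%:R : R).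
  have xV0 : 0 < (n%:R^-1 : R) by rewrite invr_gt0.
  have xV : (n%:R^-1 : R) <= 2^-1 by rewrite lef_pV2 ?posrE //; lra.
  by have := ln_le_sub1 xV0; rewrite lnV ?posrE //; lra.
have lnN : ln (#|{: vertex n}|.*2)%:R <= 3 * ln (n%:R : R).
  rewrite card_vertex // -mul2n !natrM.
  have -> : 3 * ln (n%:R : R) = ln (n%:R * (n%:R * n%:R)).
    by rewrite !lnM ?posrE ?mulr_gt0 //; ring.
  rewrite ler_ln ?posrE ?mulr_gt0 //.
  by rewrite ler_wpM2r // mulr_ge0 // ltW.
have lnN' : ln (#|{: vertex n}|)%:R <= 3 * ln (n%:R : R).
  apply: le_trans lnN; rewrite ler_ln ?posrE ?ltr0n ?double_gt0 ?card_vertex //.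
  - by rewrite ler_nat -addnn leq_addr.
  - by rewrite muln_gt0 ltnW.
  - by rewrite muln_gt0 ltnW.
apply: le_trans (ent_loyd_classes f n1 lnN) _.
apply: le_trans (lerD (ent_config_classes f n1 lnN') (lexx _)) _.
rewrite card_vertex // !natrM; move: (energy f) (energy_ge0 f) => E E0.
set x := (n%:R : R) in x0 xp ln2 *; set l := ln x in ln2 *.
have -> : (5 + 8 * (3 * l)) * (x * x) * ((300 * x) ^+ 2 * E) +
    (5 + 8 * (3 * l)) * 2 * ((300 * x) ^+ 2 * E) =
    (5 + 24 * l) * (x ^+ 2 + 2) * (300 ^+ 2 * x ^+ 2 * E) by ring.
(* [68 = 34 * 2]: [5 + 24 * l <= 34 * l] because [l >= 1/2], and [x ^+ 2 + 2 <= 2 * x ^+ 2]. *)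
have -> : 68 * 300 ^+ 2 * x ^+ 4 * l * E =
   (34 * l) * (2 * x ^+ 2) * (300 ^+ 2 * x ^+ 2 * E) by ring.
apply: ler_wpM2r.
  by apply: mulr_ge0 E0; apply: mulr_ge0 (sqr_ge0 _) (sqr_ge0 _).
have x2 : 2 * 2 <= x * x by apply: ler_pM.
by apply: ler_pM; rewrite ?expr2; lra.
Qed.

(** * Decay of entropy and mixing *)

(** The transition operator on functions; by symmetry of the chain it also evolves probability
    laws. *)
Definition step_op (R : realType) (n : nat) (u : config n -> R) (c : config n) :
    R :=
  2^-1 * u c + 2^-1 * (4^-1 * \sum_(d <- directions n) u (move c d)).

Lemma step_op_ge0 (R : realType) (n : nat) (u : config n -> R) :
  (forall c, 0 <= u c) -> forall c, 0 <= step_op u c.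
Proof.
move=> u0 c; rewrite /step_op addr_ge0 // !mulr_ge0 //.
by apply: sumr_ge0 => d _.
Qed.

Lemma big_directions (V : nmodType) (n : nat) (F : vertex n -> V) :
  \sum_(d <- directions n) F d =
  F (1, 0) + (F (-1, 0) + (F (0, 1) + F (0, -1))).
Proof. by rewrite !big_cons big_nil addr0. Qed.

(** Each value is compared with the tangent at [m]; the linear terms average to zero and the gains
    remain. Going from [v0] to a neighbour through [m] doubles squares, and laziness pays:
    [4 * 2 / 16] is the holding weight 1/2, and [2 / 16] the weight 1/8 of a neighbour. *)
Lemma xlnx_average (R : realType) (v0 v1 v2 v3 v4 : R)
    (m := 2^-1 * v0 + 2^-1 * (4^-1 * (v1 + (v2 + (v3 + v4))))) :
  0 <= v0 -> 0 <= v1 -> 0 <= v2 -> 0 <= v3 -> 0 <= v4 ->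
  m * ln m + 16^-1 *
    ((Num.sqrt v0 - Num.sqrt v1) ^+ 2 + ((Num.sqrt v0 - Num.sqrt v2) ^+ 2 +
     ((Num.sqrt v0 - Num.sqrt v3) ^+ 2 + (Num.sqrt v0 - Num.sqrt v4) ^+ 2))) <=
  2^-1 * (v0 * ln v0) + 2^-1 * (4^-1 *
    (v1 * ln v1 + (v2 * ln v2 + (v3 * ln v3 + v4 * ln v4)))).
Proof.
move=> h0 h1 h2 h3 h4; have : 0 <= m by rewrite /m; lra.
rewrite le_eqVlt => /predU1P[/esym m0|m0].
  have z0 : v0 = 0 by move: m0; rewrite /m; lra.
  have z1 : v1 = 0 by move: m0; rewrite /m; lra.
  have z2 : v2 = 0 by move: m0; rewrite /m; lra.
  have z3 : v3 = 0 by move: m0; rewrite /m; lra.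
  have z4 : v4 = 0 by move: m0; rewrite /m; lra.
  by rewrite m0 z0 z1 z2 z3 z4 subrr expr0n /= !(mul0r, mulr0, addr0).
have t0 := xlnx_ge_tangent m0 h0; have t1 := xlnx_ge_tangent m0 h1.
have t2 := xlnx_ge_tangent m0 h2; have t3 := xlnx_ge_tangent m0 h3.
have t4 := xlnx_ge_tangent m0 h4.
have sq (x y z : R) : (x - y) ^+ 2 <= 2 * (x - z) ^+ 2 + 2 * (y - z) ^+ 2.
  by have := sqr_ge0 (x + y - 2 * z); lra.
have s1 := sq (Num.sqrt v0) (Num.sqrt v1) (Num.sqrt m).
have s2 := sq (Num.sqrt v0) (Num.sqrt v2) (Num.sqrt m).
have s3 := sq (Num.sqrt v0) (Num.sqrt v3) (Num.sqrt m).
have s4 := sq (Num.sqrt v0) (Num.sqrt v4) (Num.sqrt m).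
have mE : m * ln m = 2^-1 * (v0 * ln m) + 2^-1 * (4^-1 *
  (v1 * ln m + (v2 * ln m + (v3 * ln m + v4 * ln m)))) by rewrite {1}/m; ring.
have mD : 2^-1 * (v0 - m) + 2^-1 * (4^-1 *
  ((v1 - m) + ((v2 - m) + ((v3 - m) + (v4 - m))))) = 0 by rewrite /m; field.
rewrite mE; lra.
Qed.

Lemma sum_step_op (R : realType) (n : nat) (u : config n -> R) : (1 < n)%N ->
  \sum_(c in loyd_space n) step_op u c = \sum_(c in loyd_space n) u c.
Proof.
move=> n1; rewrite /step_op big_split /= -!mulr_sumr exchange_big /=.
rewrite (eq_big_seq (fun=> \sum_(c in loyd_space n) u c)) => [|d hd].
  by rewrite big_directions; field.
by rewrite (sum_loyd_moves (w := [:: d]) u) // /word_in /= hd.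
Qed.

Lemma ent_step_op (R : realType) (n : nat) (u : config n -> R) : (1 < n)%N ->
  (forall c, 0 <= u c) ->
  ent (loyd_space n) (step_op u) <=
  ent (loyd_space n) u - 16^-1 * energy (fun c => Num.sqrt (u c)).
Proof.
move=> n1 u0; rewrite /ent sum_step_op // [leRHS]addrAC lerD2r.
rewrite lerBrDr -(sum_step_op (fun c => u c * ln (u c)) n1).
rewrite /energy mulr_sumr -big_split; apply: ler_sum => c _.
by rewrite /step_op !big_directions; apply: xlnx_average.
Qed.

Definition log_sobolev_const (R : realType) (n : nat) : R :=
  68 * 300 ^+ 2 * n%:R ^+ 4 * ln n%:R.

Lemma ent_step_op_contract (R : realType) (n : nat) (u : config n -> R)
    (G := log_sobolev_const R n) : (1 < n)%N -> 0 < G -> (forall c, 0 <= u c) ->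
  ent (loyd_space n) (step_op u) <=
  (1 - (16 * G)^-1) * ent (loyd_space n) u.
Proof.
move=> n1 G0 u0; apply: le_trans (ent_step_op n1 u0) _.
have := loyd_log_sobolev (fun c => Num.sqrt (u c)) n1.
rewrite (@eq_ent _ _ _ _ u) => [|c _]; last by rewrite sqr_sqrtr.
rewrite -/(log_sobolev_const R n) -/G => h.
rewrite mulrBl mul1r lerD2l lerN2 invfM -mulrA ler_wpM2l //.
by rewrite ler_pdivrMl.
Qed.

Lemma ent_iter_step (R : realType) (n t : nat) (u : config n -> R)
    (G := log_sobolev_const R n) :
  (1 < n)%N -> 1 <= G -> (forall c, 0 <= u c) ->
  0 <= ent (loyd_space n) u ->
  ent (loyd_space n) (iter t (@step_op R n) u) <=
  expR (- (t%:R / (16 * G))) * ent (loyd_space n) u.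
Proof.
move=> n1 G1 u0 e0; have G0 : 0 < G by lra.
set x := (16 * G)^-1.
have x1 : x <= 1 by rewrite invf_le1; lra.
apply: (@le_trans _ _ ((1 - x) ^+ t * ent (loyd_space n) u)).
  elim: t => [|t IH]; first by rewrite expr0 mul1r.
  have it0 c : 0 <= iter t (@step_op R n) u c.
    by elim: t c {IH} => //= t IH c; exact: step_op_ge0.
  apply: le_trans (ent_step_op_contract n1 G0 it0) _.
  by rewrite exprS -mulrA ler_wpM2l // subr_ge0.
apply: ler_wpM2r => //; rewrite -mulrN expRM_natl.
by apply: lerXn2r; rewrite ?nnegrE ?expR_ge0 ?subr_ge0 //; exact: expR_ge1Dx.
Qed.

(** * From entropy to the mixing time *)

Lemma sum_loyd_state (R : realType) (n : nat) (g : config n -> R) :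
  \sum_(y : loyd_state n) g (val y) = \sum_(c in loyd_space n) g c.
Proof. by rewrite (big_sub (mem (loyd_space n))). Qed.

Lemma trans_iterSr (R : realType) (S : finType) (p : S -> S -> R) (t : nat)
    (x y : S) :
  trans_iter p t.+1 x y = \sum_(z : S) trans_iter p t x z * p z y.
Proof.
elim: t x y => [|t IH] x y.
  rewrite /= (bigD1 y) //= eqxx mulr1 big1 => [|z /negPf->]; last exact: mulr0.
  rewrite [RHS](bigD1 x) //= eqxx mul1r big1 ?addr0 // => z.
  by rewrite eq_sym => /negPf->; rewrite mul0r.
rewrite -[LHS]/(\sum_z p x z * trans_iter p t.+1 z y).
under eq_bigr do rewrite IH mulr_sumr.
rewrite exchange_big /=; apply: eq_bigr => z _.
by rewrite mulr_suml; apply: eq_bigr => v _; rewrite mulrA.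
Qed.

Lemma sum_loyd_trans (R : realType) (n : nat) (u : config n -> R)
    (y : loyd_state n) : (1 < n)%N ->
  \sum_(z : loyd_state n) u (val z) * loyd_trans R n z y = step_op u (val y).
Proof.
move=> n1; under eq_bigr do rewrite loyd_trans_sym /loyd_trans.
have pick c : c \in loyd_space n ->
    \sum_(z : loyd_state n) u (val z) * (val z == c)%:R = u c.
  move=> cO; rewrite (sum_loyd_state (fun x => u x * (x == c)%:R)).
  rewrite (bigD1 c) //= eqxx mulr1 big1 ?addr0 // => x /andP[_ /negPf ->].
  by rewrite mulr0.
under eq_bigr do rewrite mulrDr mulrCA [X in _ + X]mulrCA (mulrCA _ 4^-1).
rewrite big_split /= -!mulr_sumr /step_op; congr (_ * _ + _ * (_ * _)).
  by rewrite -(pick _ (valP y)); apply: eq_bigr => z _; rewrite val_eqE.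
under eq_bigr do rewrite mulr_sumr.
rewrite exchange_big /=; apply: eq_big_seq => d hd.
by apply: pick; rewrite move_loyd_space // (valP y).
Qed.

Lemma trans_iter_loyd (R : realType) (n t : nat) (x y : loyd_state n) :
  (1 < n)%N ->
  trans_iter (loyd_trans R n) t x y =
  iter t (@step_op R n) (fun c => (c == val x)%:R) (val y).
Proof.
move=> n1; elim: t y => [|t IH] y; first by rewrite /= val_eqE eq_sym.
rewrite trans_iterSr; under eq_bigr do rewrite IH.
by rewrite sum_loyd_trans.
Qed.

(** The entropy dominates the sum of squared differences of square roots. Since [a ^+ 2 - b ^+ 2]
    factors, the weighted mean inequality bounds the sum of absolute differences by [eps + eps],
    which the factor 1/2 halves. *)
Lemma tv_dist_uniform_le (R : realType) (T : finType) (S : {set T}) (q : T -> R)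
    (eps : R) : 0 < eps -> (0 < #|S|)%N -> (forall s, 0 <= q s) ->
  \sum_(s in S) q s = 1 -> ent S q <= eps ^+ 2 ->
  2^-1 * \sum_(s in S) `|q s - #|S|%:R^-1| <= eps.
Proof.
move=> e0 S0 q0 q1; have k0 : 0 < (#|S|%:R : R) by rewrite ltr0n.
set k := #|S|%:R; pose z := k^-1; have z0 : 0 < z by rewrite invr_gt0.
have sz : \sum_(s in S) z = 1.
  by rewrite sumr_const -[z *+ _]mulr_natl divff // gt_eqF.
rewrite /ent q1 mul1r -/k -/z => entS.
have hel : \sum_(s in S) (Num.sqrt (q s) - Num.sqrt z) ^+ 2 <= eps ^+ 2.
  apply: le_trans entS; rewrite lerBrDr.
  apply: (@le_trans _ _ (\sum_(s in S)
    (q s * ln z + (q s - z) + (Num.sqrt (q s) - Num.sqrt z) ^+ 2))).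
    rewrite !big_split /= -mulr_suml q1 sumrN sz.
    by rewrite !mul1r; lra.
  by apply: ler_sum => s _; exact: xlnx_ge_tangent.
rewrite ler_pdivrMl // -/z.
apply: (@le_trans _ _ (\sum_(s in S)
  (eps^-1 * (Num.sqrt (q s) - Num.sqrt z) ^+ 2 + eps / 2 * (q s + z)))).
  apply: ler_sum => s _.
  have [qE zE] := (sqr_sqrtr (q0 s), sqr_sqrtr (ltW z0)).
  rewrite -[in `|_|]qE -[in `|_|]zE -[in q s + z]qE -[in _ + z]zE {qE zE}.
  move: (Num.sqrt (q s)) (sqrtr_ge0 (q s)) => a a0.
  move: (Num.sqrt z) (sqrtr_ge0 z) => b b0.
  rewrite subr_sqr normrM (ger0_norm (addr_ge0 a0 b0)).
  rewrite -[X in eps^-1 * X]real_normK ?num_real //.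
  set c := `|a - b|.
  have : 0 <= (eps * 4)^-1 * (2 * c - eps * (a + b)) ^+ 2.
    by rewrite mulr_ge0 ?sqr_ge0 // invr_ge0 mulr_ge0 // ltW.
  have -> : (eps * 4)^-1 * (2 * c - eps * (a + b)) ^+ 2 =
    eps^-1 * c ^+ 2 - c * (a + b) + eps / 4 * (a + b) ^+ 2.
    by field; rewrite gt_eqF.
  have : 0 <= eps * (a - b) ^+ 2 by rewrite mulr_ge0 ?sqr_ge0 // ltW.
  lra.
rewrite big_split /= -!mulr_sumr big_split /= q1 sz.
have -> : eps / 2 * (1 + 1) = eps by field.
have : eps^-1 * \sum_(s in S) (Num.sqrt (q s) - Num.sqrt z) ^+ 2 <= eps.
  by rewrite ler_pdivrMl // -expr2.
lra.
Qed.

Lemma ln_fact_le (R : realType) (n : nat) : ln (n`!%:R : R) <= n%:R ^+ 2.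
Proof.
elim: n => [|n IH]; first by rewrite fact0 ln1 sqr_ge0.
rewrite factS natrM lnM ?posrE ?ltr0n ?fact_gt0 //.
have := ln_le_sub1 (ltr0Sn R n); move: (ler0n R n).
by rewrite -natr1; lra.
Qed.

Lemma ent_dirac (R : realType) (T : finType) (S : {set T}) (s0 : T) :
  s0 \in S -> ent S (fun s => (s == s0)%:R : R) = ln #|S|%:R.
Proof.
move=> s0S; have k0 : (0 < #|S|)%N by apply/card_gt0P; exists s0.
have sum1 : \sum_(s in S) ((s == s0)%:R : R) = 1.
  by rewrite (bigD1 s0) //= eqxx big1 ?addr0 // => s /andP[_ /negPf->].
rewrite /ent sum1 mul1r div1r lnV ?posrE ?ltr0n // opprK big1 ?add0r // => s _.
by case: eqP => _; rewrite ?mul0r // ln1 mulr0.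
Qed.

Lemma mixed_at_loyd (R : realType) (n t : nat) (G := log_sobolev_const R n) :
  (1 < n)%N -> 1 <= G -> 2^-1 <= ln (n%:R : R) ->
  128 * G * ln n%:R <= t%:R ->
  mixed_at (loyd_trans R n) (uniform_dist R (loyd_state n)) (expR (-1)) t.
Proof.
move=> n1 G1 ln2 tG x; have G0 : 0 < G by lra.
pose u c : R := (c == val x)%:R; pose q := iter t (@step_op R n) u.
have u0 c : 0 <= u c by exact: ler0n.
have q0 c : 0 <= q c.
  by rewrite /q; elim: t c {tG q} => //= t IH c; exact: step_op_ge0.
have q1 : \sum_(c in loyd_space n) q c = 1.
  rewrite /q; elim: t {tG q q0} => [|t IH] /=; last by rewrite sum_step_op.
  rewrite (bigD1 (val x)) ?(valP x) //= /u eqxx big1 ?addr0 // => c.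
  by move=> /andP[_ /negPf ->].
have S0 : (0 < #|loyd_space n|)%N.
  by apply/card_gt0P; exists (val x); exact: (valP x).
have cS : #|loyd_state n| = #|loyd_space n| by rewrite card_sig.
rewrite /tv_dist /uniform_dist cS.
under eq_bigr do rewrite trans_iter_loyd // -/u -/q.
rewrite (sum_loyd_state (fun c => `|q c - #|loyd_space n|%:R^-1|)).
apply: tv_dist_uniform_le; rewrite ?expR_gt0 //.
have entu : ent (loyd_space n) u = ln #|loyd_space n|%:R.
  by rewrite ent_dirac // (valP x).
have np : 0 < (n%:R : R) by rewrite ltr0n ltnW.
have entu0 : 0 <= ent (loyd_space n) u by rewrite entu ln_ge0 // ler1n.
have entu1 : ent (loyd_space n) u <= expR (4 * ln n%:R).
  rewrite entu expRM_natl lnK ?posrE //.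
  apply: le_trans (_ : ln ((#|{: vertex n}|)`!%:R) <= _).
    rewrite ler_ln ?posrE ?ltr0n ?fact_gt0 // ler_nat.
    have -> : ((#|{: vertex n}|)`!)%N = #|{: config n}|.
      rewrite -cardsT -card_perm; apply: eq_card => s; rewrite !inE.
      by apply/fintype.subsetP => v _; rewrite inE.
    exact: max_card.
  apply: le_trans (ln_fact_le R _) _.
  by rewrite card_vertex // natrM -expr2 -exprM.
apply: le_trans (ent_iter_step t n1 G1 u0 entu0) _.
apply: le_trans (ler_wpM2l (expR_ge0 _) entu1) _.
rewrite -/G; clearbody G.
rewrite -expRD -expRM_natl ler_expR.
have G16 : 0 < 16 * G by lra.
(* The decay exponent is at least [8 * ln n] and the initial entropy at most [expR (4 * ln n)]; the
   remaining exponent [- 4 * ln n] is at most -2, and [expR (-2)] is the square of the target. *)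
have : 8 * ln n%:R <= t%:R / (16 * G).
  by rewrite (ler_pdivlMr _ _ G16); lra.
lra.
Qed.

Theorem corollary4 (R : realType) :
  exists C : R, 0 < C /\
    forall n : nat, (2 <= n)%N ->
      exists tau_mix : nat,
        is_mixing_time (loyd_trans R n) (uniform_dist R (loyd_state n))
          (expR (-1)) tau_mix /\
        tau_mix%:R <= C * n%:R ^+ 4 * ln (n%:R) ^+ 2.
Proof.
exists (129 * (68 * 300 ^+ 2)); split.
  by rewrite !mulr_gt0 ?exprn_gt0 ?ltr0n.
move=> n n1; set G := log_sobolev_const R n.
have x0 : 2 <= (n%:R : R) by rewrite ler_nat.
have ln2 : 2^-1 <= ln (n%:R : R).
  have xV0 : 0 < (n%:R^-1 : R) by rewrite invr_gt0; lra.
  have xV : (n%:R^-1 : R) <= 2^-1 by rewrite lef_pV2 ?posrE //; lra.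
  by have := ln_le_sub1 xV0; rewrite lnV ?posrE //; lra.
have K4 : 4 <= (68 * 300 ^+ 2 : R) by lra.
have constE : log_sobolev_const R n = G by [].
have GE : 68 * 300 ^+ 2 * n%:R ^+ 4 * ln n%:R = G by [].
have key (k y l : R) : 4 <= k -> 1 <= y -> 2^-1 <= l -> 2 <= k * y * l.
  move=> k4 y1 l2; have ky : 4 * 1 <= k * y by apply: ler_pM.
  have -> : 2 = 4 * 1 * 2^-1 :> R by field.
  by apply: ler_pM.
have y1 : 1 <= (n%:R : R) ^+ 4 by apply: exprn_ege1; lra.
have G2 : 2 <= G by rewrite -GE; exact: key.
clearbody G.
have G1 : 1 <= G by lra.
(* Rounding up costs at most 1, hence at most [G * ln n]; this turns 128 into 129. *)
pose t0 := (Num.truncn (128 * G * ln (n%:R : R))).+1.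
have t0P : mixed_at (loyd_trans R n) (uniform_dist R (loyd_state n))
    (expR (-1)) t0.
  by apply: mixed_at_loyd => //; rewrite constE //; exact/ltW/truncnS_gt.
have ex : exists t, `[< mixed_at (loyd_trans R n)
    (uniform_dist R (loyd_state n)) (expR (-1)) t >].
  by exists t0; exact/asboolP.
exists (ex_minn ex); case: ex_minnP => t /asboolP tP tmin; split.
  by split=> // s sP; apply: tmin; exact/asboolP.
apply: (@le_trans _ _ t0%:R); first by rewrite ler_nat; apply/tmin/asboolP.
have Gl : 1 <= G * ln n%:R.
  have : 2 * 2^-1 <= G * ln (n%:R : R) by apply: ler_pM.
  by rewrite divff.
rewrite expr2 [leRHS]mulrA -[X in _ <= X * _ * _]mulrA -[X in _ <= X * _]mulrA.
rewrite GE -mulrA.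
have tl0 : 0 <= 128 * G * ln (n%:R : R) by lra.
have /andP[h _] := truncn_itv tl0.
by rewrite /t0 -natr1; lra.
Qed.
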